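(* Let $\alpha\ge 1/2$ and $\lambda>0$. Let $X$ be an almost surely positive random variable with $\mathbb{E}[X^{\alpha+4}]<\infty$, and let $(X_\tau)_{\tau\in(0,1)}$ be the gamma smart path built from $X$. Then for every $\tau\in(0,1)$ the function $\tau\mapsto D(X_\tau\|\gamma_{\alpha,\lambda})$ is finite and differentiable, and $$\frac{d}{d\tau}D(X_\tau\|\gamma_{\alpha,\lambda})=\frac{1}{\lambda\tau}\,J_{st,\gamma}(X_\tau).$$
   Context: Fix $\alpha>0,\lambda>0$. Let $\gamma_{\alpha,\lambda}(u)=\frac{\lambda^\alpha}{\Gamma(\alpha)}u^{\alpha-1}e^{-\lambda u}$, $u>0$, and let $\gamma(\alpha,\lambda)$ denote a random variable with this density. Let $X$ be a random variable with values in $(0,\infty)$ a.s. and law $\mathbb{P}_X$. For $\tau\in(0,1)$, the gamma smart path $X_\tau$ is defined as follows: conditionally on $X=x$, let $K$ be Poisson with mean $\lambda\tau x/(1-\tau)$; conditionally on $X=x,K=k$, let $Y=0$ if $k=0$ and let $Y$ be gamma distributed with shape $k$ and rate $\lambda\tau/(1-\tau)$ if $k\ge1$; let $\gamma(\alpha,\lambda)$ be independent of $(X,K,Y)$; set $X_\tau=(1-\tau)\gamma(\alpha,\lambda)+\tau Y$. $X_\tau$ has the Lebesgue density $$g(\tau,u)=\frac{\lambda}{1-\tau}\Big(\frac{u}{\tau}\Big)^{\frac{\alpha-1}{2}}e^{-\frac{\lambda u}{1-\tau}}\int_0^\infty x^{-\frac{\alpha-1}{2}}e^{-\frac{\lambda\tau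 x}{1-\tau}}I_{\alpha-1}\Big(\frac{2\lambda\sqrt{ux\tau}}{1-\tau}\Big)\mathbb{P}_X(dx),$$ where $I_\nu$ is the modified Bessel function of the first kind. For a positive random variable $W$ with density $f$, $D(W\|\gamma_{\alpha,\lambda})=\int_0^\infty f\log(f/\gamma_{\alpha,\lambda})$ (and $+\infty$ if $W$ has no density). For a positive random variable $W$ with differentiable positive density $f_W$, let $\rho_W(u)=\frac{d}{du}\log f_W(u)$ and define the standardized Fisher information $J_{st,\gamma}(W)=\mathbb{E}\big[W\big(\rho_W(W)-\frac{\alpha-1}{W}+\lambda\big)^2\big]$. *)

(* Defs.v *)
From HB Require Import structures.
From mathcomp Require Import all_boot all_order all_algebra.
From mathcomp Require Import all_classical all_reals all_analysis.
Set Implicit Arguments. Unset Strict Implicit. Unset Printing Implicit Defensive.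
Import Order.TTheory GRing.Theory Num.Theory.
Import numFieldNormedType.Exports.
Local Open Scope classical_set_scope.
Local Open Scope ring_scope.

Section Defs.
Variable R : realType.

Definition Gamma (s : R) : R :=
  fine (\int[@lebesgue_measure R]_(t in `]0, +oo[%classic)
          ((t `^ (s - 1)) * expR (- t))%:E).

Definition gamma_pdf (alpha lam u : R) : R :=
  lam `^ alpha / Gamma alpha * u `^ (alpha - 1) * expR (- (lam * u)).

Definition besselI (nu z : R) : R :=
  limn (series (fun k : nat => (z / 2) `^ (2 * k%:R + nu)
                      / (k`!%:R * Gamma (k%:R + nu + 1)))).

Definition smart_path_density (alpha lam : R)
    (PX : {measure set R -> \bar R}) (tau u : R) : R :=
  lam / (1 - tau) * (u / tau) `^ ((alpha - 1) / 2)
  * expR (- (lam * u / (1 - tau)))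
  * fine (\int[PX]_x
        ((x `^ (- ((alpha - 1) / 2))) * expR (- (lam * tau * x / (1 - tau)))
          * besselI (alpha - 1) (2 * lam * Num.sqrt (u * x * tau) / (1 - tau)))%:E).

Definition KL_gamma (alpha lam : R) (f : R -> R) : \bar R :=
  \int[@lebesgue_measure R]_(u in `]0, +oo[%classic)
     (f u * ln (f u / gamma_pdf alpha lam u))%:E.

(* Standardized Fisher information J_{st,gamma}(W) of a positive random variable
   W with density f: E[W (rho_W(W) - (alpha-1)/W + lambda)^2],
   rho_W = (log f)'. *)
Definition Jst_gamma (alpha lam : R) (f : R -> R) : \bar R :=
  \int[@lebesgue_measure R]_(u in `]0, +oo[%classic)
     (u * (derive1 (fun v => ln (f v)) u - (alpha - 1) / u + lam) ^+ 2 * f u)%:E.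

End Defs.

(* Main.v *)
Require Import Defs.
From HB Require Import structures.
From mathcomp Require Import all_boot all_order all_algebra.
From mathcomp Require Import all_classical all_reals all_analysis.
From mathcomp Require Import measurable_realfun zify ring lra.
Set Implicit Arguments.
Unset Strict Implicit.
Unset Printing Implicit Defensive.
Import Order.TTheory GRing.Theory Num.Theory.
Import numFieldNormedType.Exports.
Local Open Scope classical_set_scope.
Local Open Scope ring_scope.

(** The smart path is a Poisson mixture of gamma laws. Put s = lam/(1 - tau) and c = lam tau/(1 -
    tau). Expanding the Bessel function shows that s X_tau has density w(y) F(c,y), with w(y) =
    y^(alpha-1) e^(-y), F(c,y) = sum_k m_k(c) y^k / Gamma(k + alpha), and m_k(c) the mean of the
    Poisson weight e^(-cX) (cX)^k / k! ([besselI_kernelE], [smart_path_densityE]). After scaling,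
    tau enters the density only through c.

    Two recurrences drive the calculus. Poisson weights give c m_k' = k m_k - (k+1) m_(k+1). The
    gamma density of shape a+1 and rate 1 has as derivative the one of shape a minus itself. Let S1
    = y d_y F, with weights k m_k, and let S2 be the series with the shifted weights (k+1) m_(k+1).
    Then c d_c F = S1 - S2 and d_y (w S1) = w (S2 - S1), so that w F solves c d_c (w F) = - d_y (y w
    d_y F). Differentiating the entropy E(c) = int w F ln F under the integral and integrating by
    parts gives the de Bruijn identity E'(c) = I(c)/c, with I = int w S1^2 / (y F)
    ([gseries_integration_by_parts], [is_derive_mixture_entropy]).

    With M1 the mean of X, the divergence is ln Gamma(alpha) - alpha ln(1 - tau) - tau (alpha + c
    M1) + E(c) ([KL_gamma_smart_path]). The centred score is s (S1/(yF) - tau), so the Fisher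
    information is s (I - 2 tau c M1 + tau^2 (alpha + c M1)) ([Jst_gamma_smart_path]). The chain
    rule with c'/c = 1/(tau (1 - tau)) then matches the two sides.

    The estimates rest on the fourth moment of X, finite because alpha + 4 exceeds 4. It gives m_k =
    O(k^-4) locally uniformly in c. Moreover F lies between a positive constant and C e^(2y), so ln
    F grows at most linearly, and a first moment of the gamma mixture dominates every integrand. *)

(** * Differentiation under the integral, scaling, and integration by parts on (0, +oo) *)

Lemma is_derive_under_integral (R : realType) d (Y : measurableType d)
    (mu : {measure set Y -> \bar R}) (B : set Y) (f df : R -> Y -> R)
    (G : Y -> R) (a u v : R) :
  measurable B -> u < a < v ->
  (forall x, u < x < v -> mu.-integrable B (EFin \o f x)) ->
  (forall x y, u < x < v -> B y -> is_derive x 1 (f ^~ y) (df x y)) ->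
  mu.-integrable B (EFin \o G) ->
  (forall x y, u < x < v -> B y -> `|df x y| <= G y) ->
  is_derive a 1 (fun x => \int[mu]_(y in B) f x y) (\int[mu]_(y in B) df a y).
Proof.
move=> mB uav intf dfE intG dfG.
have inI x : (`]u, v[%classic x) -> u < x < v by rewrite /= in_itv.
have Ia : `]u, v[%classic a by rewrite /= in_itv.
have der x y : `]u, v[%classic x -> B y -> derivable (f ^~ y) x 1.
  by move=> /inI xI By; have [] := dfE x y xI By.
have intG' : mu.-integrable B (EFin \o (fun y => `|G y|)).
  exact: integrable_norm.
have ub x y : `]u, v[%classic x -> B y -> `|partial1of2 f x y| <= `|G y|.
  move=> /inI xI By; rewrite partial1of2E; have [_ ->] := dfE x y xI By.
  by rewrite (le_trans (dfG _ _ xI By))// ler_norm.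
have intf' x : `]u, v[%classic x -> mu.-integrable B (EFin \o f x).
  by move=> /inI; exact: intf.
have G0 y : 0 <= `|G y| by [].
split.
  exact: (derivable_under_integral mB Ia intf' der G0 intG' ub).
rewrite -derive1E (differentiation_under_integral mB Ia intf' der G0 intG' ub).
apply: eq_Rintegral => y /set_mem By.
by rewrite partial1of2E; have [_ ->] := dfE a y uav By.
Qed.

(** Multiplied back by s, the image measure has the right value on half-open intervals, so
    uniqueness of Lebesgue measure identifies it. *)
Lemma lebesgue_measure_scale (R : realType) (s : R) (A : set R) : 0 < s ->
  measurable A ->
  pushforward (@lebesgue_measure R) ( *%R s : _ -> measurableTypeR R) A
    = (s^-1%:E * @lebesgue_measure R A)%E.
Proof.
move=> s0 mA.
have ms : measurable_fun [set: measurableTypeR R]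
    ( *%R s : measurableTypeR R -> measurableTypeR R).
  exact: measurable_funM.
have s10 : 0 <= s^-1 by rewrite invr_ge0 ltW.
pose f : measurableTypeR R -> measurableTypeR R := *%R s.
have := @lebesgue_measure_unique R (mscale (NngNum (ltW s0)) (pushforward (@lebesgue_measure R) f)).
move=> /(_ ms _ A mA) ->; first rewrite /mscale/= muleA -EFinM mulVf ?gt_eqF// mul1e//.
move=> _ [[a b]] _ <-; rewrite /mscale/= /pushforward.
have fab : f @^-1` `]a, b] = `](a / s), (b / s)]%classic.
  apply/seteqP; split => x /=;
    by rewrite !in_itv/= /f ltr_pdivrMr// ler_pdivlMr// mulrC.
transitivity (s%:E * @lebesgue_measure R `](a / s)%R, (b / s)%R]%classic)%E; last first.
  by rewrite -fab.
rewrite !lebesgue_measure_itv/= !lte_fin ltr_pM2r ?invr_gt0//.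
case: ifPn => _; last by rewrite mule0.
by rewrite -!EFinD -EFinM -mulrBl mulrCA mulfV ?gt_eqF// mulr1.
Qed.

Lemma ge0_integral_scale (R : realType) (s : R) (f : R -> \bar R) : 0 < s ->
  measurable_fun (`]0%R, +oo[ : set R) f -> (forall y, 0 < y -> (0 <= f y)%E) ->
  (\int[@lebesgue_measure R]_(u in `]0%R, +oo[) (s%:E * f (s * u)%R) =
   \int[@lebesgue_measure R]_(y in `]0%R, +oo[) f y)%E.
Proof.
move=> s0 mf f0.
have ms : measurable_fun [set: measurableTypeR R]
    ( *%R s : measurableTypeR R -> measurableTypeR R).
  exact: measurable_funM.
have sD : ( *%R s : _ -> measurableTypeR R) @^-1` `]0%R, +oo[ = `]0%R, +oo[%classic.
  by apply/seteqP; split => x /=; rewrite !in_itv/= !andbT pmulr_rgt0.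
have mfs : measurable_fun (`]0%R, +oo[ : set R) (f \o *%R s).
  apply: (@measurable_comp _ _ _ _ _ _ (`]0%R, +oo[ : set R)) => //.
    by move=> _ [x /= + <-]; rewrite !in_itv/= !andbT pmulr_rgt0.
rewrite ge0_integralZl//; last 2 first.
  by move=> x /=; rewrite in_itv/= andbT => x0; rewrite f0 // mulr_gt0.
  by rewrite lee_fin ltW.
have -> : (\int[@lebesgue_measure R]_(u in `]0%R, +oo[) f (s * u)%R =
  \int[pushforward (@lebesgue_measure R) ( *%R s : _ -> measurableTypeR R)]_(u in `]0%R, +oo[) f u)%E.
  rewrite ge0_integral_pushforward// ?sD//.
  by move=> y; rewrite inE/= in_itv/= andbT => /f0.
have s10 : 0 <= s^-1 by rewrite invr_ge0 ltW.
have -> : (\int[pushforward (@lebesgue_measure R) ( *%R s : _ -> measurableTypeR R)]_(u in `]0%R, +oo[) f u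
  = \int[mscale (NngNum s10) (@lebesgue_measure R)]_(u in `]0%R, +oo[) f u)%E.
  by apply: eq_measure_integral => //= A mA _; rewrite lebesgue_measure_scale.
rewrite ge0_integral_mscale//=.
  by rewrite muleA -EFinM mulfV ?gt_eqF// mul1e.
by move=> y /=; rewrite in_itv/= andbT => /f0.
Qed.

(** Positive and negative parts are scaled separately, which covers signed entropy integrands. *)
Lemma integral_scale (R : realType) (s : R) (f : R -> R) : 0 < s ->
  measurable_fun (`]0%R, +oo[ : set R) f ->
  (\int[@lebesgue_measure R]_(u in `]0%R, +oo[) (s * f (s * u))%:E =
   \int[@lebesgue_measure R]_(y in `]0%R, +oo[) (f y)%:E)%E.
Proof.
move=> s0 mf; have mf' : measurable_fun (`]0%R, +oo[ : set R) (EFin \o f) by exact/measurable_EFinP.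
have sfE : (fun u => (s * f (s * u))%:E) = (fun u => s%:E * (EFin \o f \o *%R s) u)%E.
  by apply/funext => u; rewrite EFinM.
rewrite integralE [RHS]integralE sfE; congr (_ - _)%E.
  rewrite ge0_funeposM ?ltW// (funepos_comp (EFin \o f)).
  by rewrite -[RHS](@ge0_integral_scale R s)//; exact: measurable_funepos.
rewrite ge0_funenegM ?ltW// (funeneg_comp (EFin \o f)).
by rewrite -[RHS](@ge0_integral_scale R s)//; exact: measurable_funeneg.
Qed.

(** Integration by parts in extended reals: the fundamental theorem on compact intervals exhausting
    (0, +oo), then monotone convergence of both sides. Splitting the derivative into two nonnegative
    parts lets the identity itself transfer finiteness from one integral to the other. *)
Lemma ge0_integral_derive_diff (R : realType) (H h1 h2 : R -> R) :
  (forall y : R, 0 < y -> 0 <= h1 y) -> (forall y : R, 0 < y -> 0 <= h2 y) ->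
  (forall y : R, 0 < y -> {for y, continuous h1}) ->
  (forall y : R, 0 < y -> {for y, continuous h2}) ->
  (forall y : R, 0 < y -> is_derive y 1 H (h1 y - h2 y)) ->
  H y @[y --> (0 : R)^'+] --> (0 : R) -> H y @[y --> +oo] --> (0 : R) ->
  (\int[@lebesgue_measure R]_(y in `]0%R, +oo[) (h1 y)%:E =
   \int[@lebesgue_measure R]_(y in `]0%R, +oo[) (h2 y)%:E)%E.
Proof.
move=> h1ge0 h2ge0 ch1 ch2 dH H0 Hoo.
(* The shift by 2 makes [a n < 1 < b n] hold already at n = 0. *)
pose a (n : nat) : R := n.+2%:R^-1; pose b (n : nat) : R := n.+2%:R.
pose J n : set R := `[a n, b n]%classic.
have a0 n : 0 < a n by rewrite invr_gt0.
have ab n : a n < b n.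
  by rewrite /a /b (@lt_trans _ _ 1)// ?invf_lt1// ltr1n.
have Jpos n y : J n y -> 0 < y.
  by rewrite /J/= in_itv/= => /andP[+ _]; exact: lt_le_trans.
have UJ : \bigcup_n J n = `]0, +oo[%classic.
  apply/seteqP; split=> [y [n _ /Jpos]|y]; first by rewrite /= in_itv/= andbT.
  rewrite /= in_itv/= andbT => y0.
  near \oo => n; exists n => //; rewrite /J/= in_itv/=; apply/andP; split.
    rewrite /a invf_ple ?posrE//.
    rewrite (@le_trans _ _ n%:R)// ?ler_nat//; last by rewrite leqW.
    by near: n; exact: nbhs_infty_ger.
  rewrite /b (@le_trans _ _ n%:R)// ?ler_nat//; last by rewrite leqW.
  by near: n; exact: nbhs_infty_ger.
have ndJ : nondecreasing_seq J.
  move=> m n mn; apply/subsetPset => y; rewrite /J/= !in_itv/= => /andP[am bm].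
  apply/andP; split.
    by rewrite (le_trans _ am)// /a lef_pV2 ?posrE// ler_nat.
  by rewrite (le_trans bm)// /b ler_nat.
have wc h n : (forall y : R, 0 < y -> {for y, continuous h}) ->
    {within J n, continuous (h : R -> R)}.
  move=> ch; apply: continuous_in_subspaceT => y; rewrite inE => /Jpos; exact: ch.
have mh h n : (forall y : R, 0 < y -> {for y, continuous h}) ->
    measurable_fun (J n) (h : R -> R).
  move=> /(@wc _ n) ch.
  by apply: subspace_continuous_measurable_fun => //; exact: measurable_itv.
have cvgint (h : R -> R) : (forall y : R, 0 < y -> 0 <= h y) ->
    (forall y : R, 0 < y -> {for y, continuous h}) ->
    (\int[lebesgue_measure]_(y in J n) (h y)%:E @[n --> \oo] -->
     \int[lebesgue_measure]_(y in `]0%R, +oo[) (h y)%:E)%E.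
  move=> h0 ch; rewrite -UJ.
  apply: ge0_nondecreasing_set_cvg_integral => //.
  - by move=> n; exact: measurable_itv.
  - by move=> n; apply: (@measurableT_comp _ _ _ _ _ _ EFin _ h) => //; exact: mh.
  - by move=> n y /Jpos/h0; rewrite lee_fin.
have intJ (h : R -> R) n : (forall y : R, 0 < y -> {for y, continuous h}) ->
    (@lebesgue_measure R).-integrable (J n) (EFin \o h).
  by move=> /(@wc _ n); apply: continuous_compact_integrable; exact: segment_compact.
have FTC n : (\int[lebesgue_measure]_(y in J n) (h1 y)%:E =
     (H (b n) - H (a n))%:E + \int[lebesgue_measure]_(y in J n) (h2 y)%:E)%E.
  have : (\int[lebesgue_measure]_(y in J n) (h1 y - h2 y)%:E = (H (b n))%:E - (H (a n))%:E)%E.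
    apply: continuous_FTC2 => //.
    - apply: (wc (fun y => h1 y - h2 y)) => y y0.
      by apply: continuousB; [exact: ch1|exact: ch2].
    - have cH y : 0 < y -> {for y, continuous H}.
        move=> y0; apply/differentiable_continuous/derivable1_diffP.
        by have [] := dH y y0.
      split.
      + move=> y; rewrite in_itv/= => /andP[/(lt_trans (a0 n)) y0 _].
        by have [] := dH y y0.
      + by apply: cvg_at_right_filter; apply: cH.
      + by apply: cvg_at_left_filter; apply: cH; rewrite (lt_trans (a0 n)).
    - move=> y; rewrite in_itv/= => /andP[/(lt_trans (a0 n)) y0 _].
      by rewrite derive1E; have [_ ->] := dH y y0.
  under eq_integral do rewrite EFinB.
  have mJ : measurable (J n : set (measurableTypeR R)) by exact: measurable_itv.
  rewrite (integralB_EFin mJ (intJ h1 n ch1) (intJ h2 n ch2)).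
  have fin2 : (\int[lebesgue_measure]_(y in J n) (h2 y)%:E \is a fin_num)%E.
    by apply: integrable_fin_num => //; exact: intJ.
  by rewrite EFinB => <-; rewrite subeK.
have cvg12 : (\int[lebesgue_measure]_(y in J n) (h1 y)%:E @[n --> \oo] -->
     0%:E + \int[lebesgue_measure]_(y in `]0%R, +oo[) (h2 y)%:E)%E.
  rewrite (_ : (fun n => _) = (fun n => (H (b n) - H (a n))%:E +
    \int[lebesgue_measure]_(y in J n) (h2 y)%:E)%E); last exact/funext.
  apply: cvgeD; last exact: cvgint.
    by rewrite fin_num_adde_defr.
  apply: cvg_EFin; first exact: nearW.
  rewrite /comp/= -[X in _ --> X]subr0; apply: cvgB.
    have bn : b n @[n --> \oo] --> +oo.
      apply/cvgryPge => M; near=> n.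
      rewrite /b (@le_trans _ _ n%:R)// ?ler_nat//; last by rewrite leqW.
      by near: n; exact: nbhs_infty_ger.
    exact: (cvg_comp _ _ bn Hoo).
  move/cvg_at_rightP : H0; apply; split => //.
  rewrite (_ : a = fun n => harmonic (n + 1)%N); last first.
    by apply/funext => n; rewrite /a /= addn1.
  have := @cvg_harmonic R; rewrite -(cvg_shiftn 1); exact.
rewrite add0e in cvg12.
by apply: (cvg_unique _ (cvgint h1 h1ge0 ch1) cvg12); exact: ereal_hausdorff.
Unshelve. all: end_near. Qed.

(** * The Gamma function: finiteness, recurrence, and a pointwise lower bound *)

Section GammaFunction.
Context {R : realType}.
Implicit Types a t y : R.
Local Notation mu := (@lebesgue_measure R).
Local Notation Rpos := (`]0%R, +oo[%classic : set R).

Let mRpos : measurable (Rpos : set (measurableTypeR R)).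
Proof. exact: measurable_itv. Qed.

Lemma continuous_powR a y : 0 < y -> {for y, continuous (@powR R ^~ a)}.
Proof.
move=> y0; apply/differentiable_continuous/derivable1_diffP.
by apply: derivable_powR; rewrite in_itv/= y0.
Qed.

Lemma continuous_expRN : continuous (fun t : R => expR (- t)).
Proof.
by move=> t; apply: continuous_comp; [exact: continuousN|exact: continuous_expR].
Qed.

Lemma is_derive_powR_expRN a y : 0 < y ->
  is_derive y 1 (fun t => t `^ a * expR (- t))
    (a * (y `^ (a - 1) * expR (- y)) - y `^ a * expR (- y)).
Proof.
move=> y0.
have de : is_derive y 1 (fun t : R => expR (- t)) (- expR (- y)).
  apply: is_derive_eq; rewrite /GRing.scale/=; ring.
have dp := is_derive1_powR a y0.
apply: is_derive_eq.
rewrite /GRing.scale/=; ring.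
Qed.

(** This is ln x <= x at x = t/(2a), multiplied by a and exponentiated. *)
Lemma powR_le_expR_half a t : 0 < a -> 0 < t ->
  t `^ a <= (2 * a) `^ a * expR (t / 2).
Proof.
move=> a0 t0; rewrite /powR !gt_eqF ?mulr_gt0// -expRD ler_expR.
have a20 : 0 < 2 * a by rewrite mulr_gt0.
have : ln (t / (2 * a)) <= t / (2 * a) by apply/ltW/ln_sublinear; rewrite divr_gt0.
rewrite ln_div ?posrE// lerBlDr => /(ler_wpM2l (ltW a0)) /le_trans; apply.
rewrite mulrDr addrC lerD2l [leLHS](_ : _ = t / 2)//.
by field; rewrite gt_eqF.
Qed.

Lemma cvg_powR_expRN_0 a : 0 < a -> (t `^ a * expR (- t)) @[t --> 0^'+] --> (0 : R).
Proof.
move=> a0; rewrite -[X in _ --> X](mul0r (expR (- 0))); apply: cvgM.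
  exact: powR_cvg0.
by apply: cvg_at_right_filter; exact: continuous_expRN.
Qed.

Lemma cvg_powR_expRN_y a : 0 < a -> (t `^ a * expR (- t)) @[t --> +oo] --> (0 : R).
Proof.
move=> a0.
apply: (@squeeze_cvgr _ _ _ _ (cst 0) (fun t => (2 * a) `^ a * expR (- (2^-1 * t)))).
- near=> t; rewrite mulr_ge0 ?powR_ge0 ?expR_ge0//=.
  have t0 : 0 < t by near: t; exact: nbhs_pinfty_gt.
  apply: (@le_trans _ _ ((2 * a) `^ a * expR (t / 2) * expR (- t))).
    by rewrite ler_wpM2r ?expR_ge0// powR_le_expR_half.
  by rewrite -mulrA -expRD (_ : t / 2 - t = - (2^-1 * t))//; field.
- exact: cvg_cst.
- rewrite -[X in _ --> X](mulr0 ((2 * a) `^ a)); apply: cvgMr.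
  apply: (@cvg_comp _ _ _ ( *%R 2^-1) (fun x => expR (- x)) _ (pinfty_nbhs R)).
    exact: gt0_cvgMry.
  exact: cvgr_expR.
Unshelve. all: end_near. Qed.

(** Integration by parts with boundary function t^a e^(-t). The identity is between extended reals,
    so finiteness can be deduced from it. *)
Lemma Gamma_integral_rec a : 0 < a ->
  (a%:E * \int[mu]_(t in Rpos) (t `^ (a - 1) * expR (- t))%:E =
   \int[mu]_(t in Rpos) (t `^ a * expR (- t))%:E)%E.
Proof.
move=> a0.
have cpe b y : 0 < y -> {for y, continuous (fun t => t `^ b * expR (- t))}.
  by move=> y0; apply: continuousM; [exact: continuous_powR|exact: continuous_expRN].
rewrite -ge0_integralZl//; last 3 first.
- apply/measurable_EFinP/measurable_funTS/measurable_funM.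
    exact: measurable_powR.
  exact: continuous_measurable_fun continuous_expRN.
- by move=> t _; rewrite lee_fin mulr_ge0 ?powR_ge0 ?expR_ge0.
- by rewrite lee_fin ltW.
under eq_integral do rewrite -EFinM.
apply: (@ge0_integral_derive_diff _ (fun t => t `^ a * expR (- t))).
- by move=> y y0; rewrite !mulr_ge0 ?powR_ge0 ?expR_ge0// ltW.
- by move=> y y0; rewrite !mulr_ge0 ?powR_ge0 ?expR_ge0.
- by move=> y y0; apply: continuousM; [exact: cst_continuous|exact: cpe].
- by move=> y y0; exact: cpe.
- by move=> y y0; exact: is_derive_powR_expRN.
- exact: cvg_powR_expRN_0.
- exact: cvg_powR_expRN_y.
Qed.

Lemma integrable_expRN_half : mu.-integrable Rpos (fun t => (expR (- (t / 2)))%:E).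
Proof.
have h : (0 : R) < 2^-1 by rewrite invr_gt0.
have := integrableS measurableT mRpos (@subsetT _ _) (integrable_exponential_pdf h).
move=> /(integrableZl mRpos 2).
apply: eq_integrable => //= t; rewrite inE/= in_itv/= andbT => t0.
by rewrite exponential_pdfE ?ltW// -EFinM mulrA mulfV// mul1r mulNr mulrC.
Qed.

(** The exponent a - 1 may be negative, so the exponential bound is applied to exponent a, where
    there is no singularity at 0, and the recurrence brings finiteness down. *)
Lemma Gamma_integral_lty a : 0 < a ->
  (\int[mu]_(t in Rpos) (t `^ (a - 1) * expR (- t))%:E < +oo)%E.
Proof.
move=> a0.
have fin : (\int[mu]_(t in Rpos) (t `^ a * expR (- t))%:E < +oo)%E.
  apply: (@le_lt_trans _ _
      (\int[mu]_(t in Rpos) (((2 * a) `^ a)%:E * (expR (- (t / 2)))%:E))%E).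
    apply: ge0_le_integral => //.
    - by move=> t _; rewrite lee_fin mulr_ge0 ?powR_ge0 ?expR_ge0.
    - apply/measurable_EFinP/measurable_funTS/measurable_funM.
        exact: measurable_powR.
      exact: continuous_measurable_fun continuous_expRN.
    - by have /(integrableZl mRpos ((2 * a) `^ a))/measurable_int := integrable_expRN_half.
    - move=> t /=; rewrite in_itv/= andbT => t0; rewrite -EFinM lee_fin.
      apply: (@le_trans _ _ ((2 * a) `^ a * expR (t / 2) * expR (- t))).
        by rewrite ler_wpM2r ?expR_ge0// powR_le_expR_half.
      by rewrite -mulrA -expRD (_ : t / 2 - t = - (t / 2))//; field.
  by have := integrable_lty mRpos (integrableZl mRpos ((2 * a) `^ a) integrable_expRN_half).
rewrite -Gamma_integral_rec// in fin.
rewrite ltey; apply: contraTneq fin => ->.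
by rewrite gt0_muley ?lte_fin// ltxx.
Qed.

Lemma Gamma_integralE a : 0 < a ->
  (\int[mu]_(t in Rpos) (t `^ (a - 1) * expR (- t))%:E = (Gamma a)%:E)%E.
Proof.
move=> a0; rewrite /Gamma fineK// ge0_fin_numE ?Gamma_integral_lty//.
by apply: integral_ge0 => t _; rewrite lee_fin mulr_ge0 ?powR_ge0 ?expR_ge0.
Qed.

Lemma GammaS a : 0 < a -> Gamma (a + 1) = a * Gamma a.
Proof.
move=> a0; apply: EFin_inj; rewrite EFinM -!Gamma_integralE ?addr_gt0//.
by rewrite Gamma_integral_rec// addrK.
Qed.

(** Restrict the Gamma integral to [y, y+1], where t^(a-1) is at least y^(a-1) and e^(-t) at least
    e^(-y-1). Equivalently, gamma densities of rate 1 and shape at least 1 are bounded by e,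
    uniformly in the shape; this controls the tail of the mixture. *)
Lemma Gamma_lower_bound a y : 1 <= a -> 0 < y ->
  y `^ (a - 1) * expR (- y) <= expR 1 * Gamma a.
Proof.
move=> a1 y0; rewrite -ler_pdivrMl ?expR_gt0// -expRN -lee_fin.
rewrite -Gamma_integralE ?(lt_le_trans _ a1)//.
set c := expR (- 1) * _.
apply: (@le_trans _ _ (\int[mu]_(t in `[y, (y + 1)%R]) c%:E)%E).
  rewrite integral_cst//= lebesgue_measure_itv/= lte_fin ltrDl ltr01.
  by rewrite -EFinD addrAC subrr add0r mule1.
have mf : measurable_fun Rpos (fun t : R => (t `^ (a - 1) * expR (- t))%:E).
  apply/measurable_EFinP/measurable_funTS/measurable_funM.
    exact: measurable_powR.
  exact: continuous_measurable_fun continuous_expRN.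
have sub : `[y, y + 1]%classic `<=` Rpos.
  by move=> t /=; rewrite !in_itv/= andbT => /andP[/(lt_le_trans y0)].
apply: (@le_trans _ _ (\int[mu]_(t in `[y, (y + 1)%R]) (t `^ (a - 1) * expR (- t))%:E)%E).
  apply: ge0_le_integral => //.
  - by move=> t _; rewrite lee_fin !mulr_ge0 ?powR_ge0 ?expR_ge0.
  - exact: measurable_funS mf.
  - move=> t /=; rewrite in_itv/= => /andP[yt ty]; rewrite lee_fin /c mulrCA.
    rewrite ler_pM ?powR_ge0 ?mulr_ge0 ?expR_ge0//.
      by rewrite ge0_ler_powR ?subr_ge0// nnegrE ltW// (lt_le_trans y0).
    by rewrite -expRD ler_expR; lra.
apply: ge0_subset_integral => //.
by move=> t _; rewrite lee_fin mulr_ge0 ?powR_ge0 ?expR_ge0.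
Qed.

Lemma Gamma_gt0 a : 0 < a -> 0 < Gamma a.
Proof.
have ge1 (b : R) : 1 <= b -> 0 < Gamma b.
  move=> b1; have := Gamma_lower_bound b1 (ltr01 : 0 < (1 : R)).
  rewrite powR1 mul1r => /(lt_le_trans (expR_gt0 _)).
  by rewrite pmulr_rgt0 ?expR_gt0.
move=> a0; rewrite -(pmulr_rgt0 _ a0) -GammaS//; apply: ge1.
by rewrite lerDr ltW.
Qed.

End GammaFunction.

(** * Series as integrals over the counting measure *)

Section CountingSeries.
Context {R : realType}.
Local Notation cnt := (@counting nat R).

Lemma nneseries_recl_shift (f : nat -> \bar R) : (forall k, 0 <= f k)%E ->
  (\sum_(k <oo) f k = f 0%N + \sum_(k <oo) f k.+1)%E.
Proof.
move=> f0; rewrite nneseries_recl//; congr (_ + _)%E.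
rewrite -(@nneseries_addn _ f 1)//.
by apply: eq_eseriesr => i _; rewrite addn1.
Qed.

Lemma eseries_expR (y : R) : 0 <= y ->
  (\sum_(k <oo) (y ^+ k / k`!%:R)%:E = (expR y)%:E)%E.
Proof.
move=> y0; rewrite -(EFin_lim (@is_cvg_series_exp_coeff R y)).
by congr (limn _); apply/funext => n; rewrite /= -sumEFin.
Qed.

(** Reading series as integrals makes the dominated differentiation lemma apply to sums as well. *)
Lemma counting_integrable_lty (f : nat -> R) :
  (\sum_(k <oo) `|f k|%:E < +oo)%E -> cnt.-integrable setT (EFin \o f).
Proof.
move=> fin; apply/integrableP; split=> //.
by rewrite ge0_integral_count.
Qed.

Lemma Rintegral_countE (f : nat -> R) : (forall k, 0 <= f k) ->
  cnt.-integrable setT (EFin \o f) ->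
  ((\int[cnt]_k f k)%:E = \sum_(k <oo) (f k)%:E)%E.
Proof.
move=> f0 intf; rewrite /Rintegral fineK; last exact: integrable_fin_num.
by rewrite ge0_integral_count// => k; rewrite lee_fin.
Qed.

Lemma Rintegral_count_recl (f : nat -> R) : (forall k, 0 <= f k) ->
  cnt.-integrable setT (EFin \o f) ->
  \int[cnt]_k f k = f 0%N + \int[cnt]_k f k.+1.
Proof.
move=> f0 intf.
have sE : (\sum_(k <oo) (f k)%:E = (f 0%N)%:E + \sum_(k <oo) (f k.+1)%:E)%E.
  by rewrite nneseries_recl_shift// => k; rewrite lee_fin.
have intfS : cnt.-integrable setT (EFin \o (fun k => f k.+1)).
  apply: counting_integrable_lty.
  under eq_eseriesr do rewrite ger0_norm//.
  apply: (@le_lt_trans _ _ (\sum_(k <oo) (f k)%:E)%E).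
    by rewrite sE leeDr// lee_fin.
  by rewrite -Rintegral_countE// ltry.
by apply: EFin_inj; rewrite EFinD !Rintegral_countE.
Qed.

Lemma term_le_Rintegral_count (f : nat -> R) n : (forall k, 0 <= f k) ->
  cnt.-integrable setT (EFin \o f) -> f n <= \int[cnt]_k f k.
Proof.
move=> f0 intf; rewrite -lee_fin Rintegral_countE//.
rewrite (@nneseriesD1 R _ n xpredT)//; last by move=> k _; rewrite lee_fin.
by rewrite leeDl// nneseries_ge0// => k _ _; rewrite lee_fin.
Qed.

End CountingSeries.

(** * Power series with coefficients 1/Gamma(k + alpha), and their gamma mixtures *)

(** Normalising constant of the gamma law of shape k + alpha and rate 1; locking keeps the Gamma
    integral folded. *)
HB.lock Definition gcoef (R : realType) (alpha : R) (k : nat) : R :=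
  (Gamma (k%:R + alpha))^-1.

(** Unnormalised gamma density of shape alpha and rate 1: [gweight alpha y * (gcoef alpha k * y ^+
    k)] is the gamma density of shape k + alpha. *)
HB.lock Definition gweight (R : realType) (alpha y : R) : R :=
  y `^ (alpha - 1) * expR (- y).

Section GammaSeries.
Context {R : realType}.
Variable alpha : R.
Hypothesis alpha_gt0 : 0 < alpha.
Local Notation mu := (@lebesgue_measure R).
Local Notation cnt := (@counting nat R).
Local Notation Rpos := (`]0%R, +oo[%classic : set R).
Let mRpos : measurable (Rpos : set (measurableTypeR R)).
Proof. exact: measurable_itv. Qed.

Local Notation gcoef := (gcoef alpha).
Local Notation gweight := (gweight alpha).

Lemma gweightE y : gweight y = y `^ (alpha - 1) * expR (- y).
Proof. by rewrite [in LHS]unlock. Qed.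

Lemma gcoefE k : gcoef k = (Gamma (k%:R + alpha))^-1.
Proof. by rewrite unlock. Qed.

(** For probability weights [n], [gweight y * gseries n y] is the density of the mixture of the
    gamma laws of shape k + alpha. As an integral over the counting measure it inherits linearity
    and dominated differentiation. *)
Definition gseries (n : nat -> R) (y : R) : R :=
  \int[cnt]_k (n k * (gcoef k * y ^+ k)).

Let kalpha_gt0 (k : nat) : 0 < k%:R + alpha.
Proof. by rewrite ltr_wpDl. Qed.

Lemma gcoef_gt0 k : 0 < gcoef k.
Proof. by rewrite gcoefE invr_gt0 Gamma_gt0. Qed.

Lemma gcoef_rec k : gcoef k = (k%:R + alpha) * gcoef k.+1.
Proof.
rewrite !gcoefE -natr1 (addrAC k%:R) GammaS// invfM mulrA mulfV ?mul1r//.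
by rewrite gt_eqF.
Qed.

Lemma gweight_ge0 y : 0 <= gweight y.
Proof. by rewrite gweightE mulr_ge0 ?powR_ge0 ?expR_ge0. Qed.

Lemma gweight_gt0 y : 0 < y -> 0 < gweight y.
Proof. by move=> y0; rewrite gweightE mulr_gt0 ?powR_gt0 ?expR_gt0. Qed.

Lemma measurable_gweight (D : set R) : measurable_fun D gweight.
Proof.
rewrite (funext gweightE).
apply: measurable_funTS; apply: measurable_funM; first exact: measurable_powR.
exact: continuous_measurable_fun continuous_expRN.
Qed.

Lemma gweightX (k : nat) y : 0 < y ->
  gweight y * y ^+ k = y `^ (k%:R + alpha - 1) * expR (- y).
Proof.
move=> y0; rewrite gweightE mulrAC -powR_mulrn ?ltW// -powRD.
  by rewrite addrC addrA.
by rewrite (gt_eqF y0) implybT.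
Qed.

Lemma integral_gweightX k :
  (\int[mu]_(y in Rpos) (gweight y * (gcoef k * y ^+ k))%:E = 1)%E.
Proof.
transitivity ((gcoef k)%:E *
    \int[mu]_(y in Rpos) (y `^ (k%:R + alpha - 1) * expR (- y))%:E)%E.
  rewrite -ge0_integralZl//; last 3 first.
  - apply/measurable_EFinP/measurable_funTS/measurable_funM.
      exact: measurable_powR.
    exact: continuous_measurable_fun continuous_expRN.
  - by move=> t _; rewrite lee_fin mulr_ge0 ?powR_ge0 ?expR_ge0.
  - by rewrite lee_fin ltW// gcoef_gt0.
  apply: eq_integral => y; rewrite inE/= in_itv/= andbT => y0.
  by rewrite -EFinM -gweightX// mulrCA.
by rewrite Gamma_integralE// gcoefE -EFinM mulVf// gt_eqF// Gamma_gt0.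
Qed.

(** Each recurrence step divides by k + 1 + alpha, which is at least k + 1; hence the series is
    compared with the exponential one. *)
Lemma gcoef_le k : gcoef k.+1 <= gcoef 1 / k`!%:R.
Proof.
elim: k => [|k ih]; first by rewrite fact0 divr1.
have h : gcoef k.+2 = gcoef k.+1 / (k.+1%:R + alpha).
  by rewrite (gcoef_rec k.+1) mulrC mulKf// gt_eqF.
have i1 : (k.+1%:R + alpha)^-1 <= k.+1%:R^-1 :> R.
  by rewrite lef_pV2 ?posrE// lerDl ltW.
rewrite h factS natrM invfM mulrCA mulrC; apply: ler_pM => //.
- by rewrite invr_ge0 ltW.
- exact/ltW/gcoef_gt0.
Qed.

Let term_ge0 k (y : R) : 0 <= y -> 0 <= gcoef k * y ^+ k.
Proof. by move=> y0; rewrite mulr_ge0 ?exprn_ge0// ltW// gcoef_gt0. Qed.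

Lemma eseries_gcoef_le y : 0 <= y ->
  (\sum_(k <oo) (gcoef k * y ^+ k)%:E <=
   (gcoef 0 + gcoef 1 * y * expR y)%:E)%E.
Proof.
move=> y0; rewrite nneseries_recl_shift; last by move=> k; rewrite lee_fin term_ge0.
rewrite expr0 mulr1 EFinD leeD2l//.
rewrite EFinM -eseries_expR// -nneseriesZl//; last first.
  by move=> k _; rewrite lee_fin divr_ge0// exprn_ge0.
apply: lee_nneseries => [k _ _|k _]; first by rewrite lee_fin term_ge0.
rewrite -EFinM lee_fin exprS.
rewrite (_ : _ * y * _ = gcoef 1 / k`!%:R * (y * y ^+ k)); last by ring.
by rewrite ler_wpM2r ?mulr_ge0 ?exprn_ge0// gcoef_le.
Qed.

Lemma integrable_gseries (n : nat -> R) C y : 0 <= y ->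
  (forall k, `|n k| <= C) ->
  cnt.-integrable setT (EFin \o (fun k => n k * (gcoef k * y ^+ k))).
Proof.
move=> y0 nC; apply: counting_integrable_lty.
have C0 : 0 <= C by rewrite (le_trans _ (nC 0%N)).
apply: (@le_lt_trans _ _ (\sum_(k <oo) (C%:E * (gcoef k * y ^+ k)%:E))%E).
  apply: lee_nneseries => [k _ _|k _]; first by rewrite lee_fin.
  by rewrite -EFinM lee_fin normrM (ger0_norm (term_ge0 _ y0)) ler_wpM2r ?term_ge0.
rewrite nneseriesZl//; last by move=> k _; rewrite lee_fin term_ge0.
by rewrite lte_mul_pinfty ?lee_fin// (le_lt_trans (eseries_gcoef_le y0))// ltry.
Qed.

Lemma gseriesE (n : nat -> R) C y : 0 <= y ->
  (forall k, 0 <= n k <= C) ->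
  ((gseries n y)%:E = \sum_(k <oo) (n k * (gcoef k * y ^+ k))%:E)%E.
Proof.
move=> y0 nC; rewrite -Rintegral_countE//.
  by move=> k; have /andP[? _] := nC k; rewrite mulr_ge0// term_ge0.
by apply: (@integrable_gseries _ C) => // k; have /andP[? ?] := nC k; rewrite ger0_norm.
Qed.

Lemma gseries_ge0 (n : nat -> R) y : 0 <= y -> (forall k, 0 <= n k) ->
  0 <= gseries n y.
Proof. by move=> y0 n0; apply: Rintegral_ge0 => k _; rewrite mulr_ge0// term_ge0. Qed.

Lemma gseries_ge_head (n : nat -> R) C y : 0 <= y -> (forall k, 0 <= n k <= C) ->
  n 0%N * gcoef 0 <= gseries n y.
Proof.
move=> y0 nC; have : forall k, 0 <= n k * (gcoef k * y ^+ k).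
  by move=> k; have /andP[? _] := nC k; rewrite mulr_ge0// term_ge0.
move=> /(@term_le_Rintegral_count R _ 0); rewrite expr0 mulr1; apply.
by apply: (@integrable_gseries _ C) => // k; have /andP[? ?] := nC k; rewrite ger0_norm.
Qed.

(** One factor e^y is the exponential series, the other absorbs the prefactors 1 and y. *)
Lemma gseries_le (n : nat -> R) y : 0 <= y -> (forall k, 0 <= n k <= 1) ->
  gseries n y <= (gcoef 0 + gcoef 1) * expR (2 * y).
Proof.
move=> y0 n1; rewrite -lee_fin (gseriesE y0 n1).
apply: (@le_trans _ _ (\sum_(k <oo) (gcoef k * y ^+ k)%:E)%E).
  apply: lee_nneseries => [k _ _|k _]; have /andP[? ?] := n1 k.
    by rewrite lee_fin mulr_ge0// term_ge0.
  by rewrite lee_fin ler_piMl// term_ge0.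
apply: le_trans (eseries_gcoef_le y0) _; rewrite lee_fin mulrDl.
apply: lerD.
  by rewrite ler_peMr ?(ltW (gcoef_gt0 _))// (le_trans _ (expR_ge1Dx _))//; lra.
rewrite -mulrA ler_pM2l ?gcoef_gt0// (_ : 2 * y = y + y); last by ring.
rewrite expRD ler_pM2r ?expR_gt0// (le_trans _ (expR_ge1Dx y))//; lra.
Qed.

Lemma gseriesB (n p : nat -> R) C C' y : 0 <= y ->
  (forall k, `|n k| <= C) -> (forall k, `|p k| <= C') ->
  gseries n y - gseries p y = gseries (fun k => n k - p k) y.
Proof.
move=> y0 nC pC; rewrite /gseries -RintegralB//.
- by apply: eq_Rintegral => k _; rewrite mulrBl.
- exact: integrable_gseries nC.
- exact: integrable_gseries pC.
Qed.

Lemma gseriesD (n p : nat -> R) C C' y : 0 <= y ->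
  (forall k, `|n k| <= C) -> (forall k, `|p k| <= C') ->
  gseries n y + gseries p y = gseries (fun k => n k + p k) y.
Proof.
move=> y0 nC pC; rewrite /gseries -RintegralD//.
- by apply: eq_Rintegral => k _; rewrite mulrDl.
- exact: integrable_gseries nC.
- exact: integrable_gseries pC.
Qed.

Lemma gseriesZ (n : nat -> R) C a y : 0 <= y -> (forall k, `|n k| <= C) ->
  a * gseries n y = gseries (fun k => a * n k) y.
Proof.
move=> y0 nC; rewrite /gseries -RintegralZl//.
- by apply: eq_Rintegral => k _; rewrite mulrA.
- exact: integrable_gseries nC.
Qed.

End GammaSeries.

(** * Derivatives, moments and boundary behaviour of gamma mixtures *)

Section GammaSeriesCalculus.
Context {R : realType}.
Variable alpha : R.
Hypothesis alpha_gt0 : 0 < alpha.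
Local Notation mu := (@lebesgue_measure R).
Local Notation cnt := (@counting nat R).
Local Notation Rpos := (`]0%R, +oo[%classic : set R).
Local Notation gcoef := (gcoef alpha).
Local Notation gweight := (gweight alpha).
Local Notation gseries := (gseries alpha).
Let mRpos : measurable (Rpos : set (measurableTypeR R)).
Proof. exact: measurable_itv. Qed.

Implicit Types (n : nat -> R) (C K x y : R) (k : nat).

Let kalpha_gt0 (k : nat) : 0 < k%:R + alpha.
Proof. by rewrite ltr_wpDl. Qed.
Let term_ge0 k (y : R) : 0 <= y -> 0 <= gcoef k * y ^+ k.
Proof. by move=> y0; rewrite mulr_ge0 ?exprn_ge0// ltW// gcoef_gt0. Qed.

(** Termwise differentiation. The Euler operator y d/dy multiplies the k-th weight by k, so the
    derivative is again a [gseries], divided by y. *)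
Lemma is_derive_gseries n C y : 0 < y ->
  (forall k, `|n k| <= C) -> (forall k, `|k%:R * n k| <= C) ->
  is_derive y 1 (gseries n) (gseries (fun k => k%:R * n k) y / y).
Proof.
move=> y0 nC knC.
have C0 : 0 <= C by rewrite (le_trans _ (nC 0%N)).
pose df (x : R) k := n k * (gcoef k * (k%:R * x ^+ k.-1)).
(* On (y/2, 2y), 1/x is at most 1/(y/2) and x^k at most (2y)^k. *)
pose G (k : nat) := C / (y / 2) * (gcoef k * (2 * y) ^+ k).
have y20 : 0 < y / 2 by rewrite divr_gt0.
have dfE x k : 0 < x -> df x k = (k%:R * n k) * (gcoef k * x ^+ k) / x.
  move=> x0; rewrite /df; case: k => [|k]; first by rewrite !(mul0r, mulr0).
  by rewrite /= exprS; field; rewrite gt_eqF.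
have := @is_derive_under_integral R _ _ cnt setT
  (fun x k => n k * (gcoef k * x ^+ k)) df G y (y / 2) (2 * y).
move=> /(_ measurableT).
have -> : \int[cnt]_k df y k = gseries (fun k => k%:R * n k) y / y.
  rewrite /gseries -RintegralZr//; last exact: (integrable_gseries alpha_gt0 (ltW y0) knC).
  by apply: eq_Rintegral => k _; rewrite dfE.
apply.
- by apply/andP; split; lra.
- move=> x /andP[yx _]; apply: (integrable_gseries alpha_gt0 _ nC).
  by rewrite ltW// (lt_trans _ yx).
- move=> x k _ _; rewrite /df.
  have dx : is_derive x 1 (fun t : R => t ^+ k) (k%:R * x ^+ k.-1).
    by apply: DeriveDef; [exact: exprn_derivable|rewrite exp_derive/GRing.scale/= mulr1].
  apply: is_derive_eq; by rewrite /GRing.scale.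
- have : cnt.-integrable setT (EFin \o (fun k => (fun=> C / (y / 2)) k * (gcoef k * (2 * y) ^+ k))).
    by apply: (integrable_gseries alpha_gt0 (C := `|C / (y / 2)|)) => //; lra.
  by [].
- move=> x k /andP[yx xy] _; have x0 : 0 < x by rewrite (lt_trans _ yx).
  rewrite dfE// mulrAC normrM [X in _ * X]ger0_norm ?term_ge0 ?(ltW x0)//.
  rewrite normrM normfV (gtr0_norm x0) /G; apply: ler_pM => //.
  + by rewrite mulr_ge0// invr_ge0 ltW.
  + exact/term_ge0/ltW.
  + apply: ler_pM => //; rewrite ?invr_ge0 ?(ltW x0)// lef_pV2 ?posrE//; exact: ltW.
  + rewrite ler_pM2l ?gcoef_gt0// lerXn2r ?nnegrE//; lra.
Qed.

Lemma continuous_gseries n C y : 0 < y ->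
  (forall k, `|n k| <= C) -> (forall k, `|k%:R * n k| <= C) ->
  {for y, continuous (gseries n)}.
Proof.
move=> y0 nC knC; apply/differentiable_continuous/derivable1_diffP.
by have [] := is_derive_gseries y0 nC knC.
Qed.

Lemma measurable_gseries n C :
  (forall k, `|n k| <= C) -> (forall k, `|k%:R * n k| <= C) ->
  measurable_fun Rpos (gseries n).
Proof.
move=> nC knC; apply: open_continuous_measurable_fun; first exact: interval_open.
move=> y; rewrite inE/= in_itv/= andbT => y0; exact: continuous_gseries nC knC.
Qed.

(** Tonelli, each gamma density having mass 1. *)
Lemma integral_gweight_gseries n C : (forall k, 0 <= n k <= C) ->
  (\int[mu]_(y in Rpos) (gweight y * gseries n y)%:E = \sum_(k <oo) (n k)%:E)%E.
Proof.
move=> nC; have n0 k : 0 <= n k by have /andP[] := nC k.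
transitivity (\int[mu]_(y in Rpos)
    \sum_(k <oo) ((n k)%:E * (gweight y * (gcoef k * y ^+ k))%:E))%E.
  apply: eq_integral => y; rewrite inE/= in_itv/= andbT => y0.
  rewrite EFinM (gseriesE alpha_gt0 (ltW y0) nC) -nneseriesZl//; last first.
    by move=> k _; rewrite lee_fin mulr_ge0// term_ge0// ltW.
  by apply: eq_eseriesr => k _; rewrite -!EFinM mulrCA.
have mterm k : measurable_fun Rpos (fun y : R => (gweight y * (gcoef k * y ^+ k))%:E).
  apply/measurable_EFinP/measurable_funM; first exact: measurable_gweight.
  by apply: measurable_funM => //; exact: measurable_funX.
have term0 k (y : R) : Rpos y -> (0 <= (gweight y * (gcoef k * y ^+ k))%:E)%E.
  rewrite /= in_itv/= andbT => y0.
  by rewrite lee_fin mulr_ge0 ?gweight_ge0// term_ge0// ltW.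
rewrite integral_nneseries//.
- apply: eq_eseriesr => k _; rewrite ge0_integralZl ?lee_fin//; [|exact: mterm|exact: term0].
  by rewrite integral_gweightX// mule1.
- by move=> k; apply: emeasurable_funM => //; exact: mterm.
- by move=> k y Dy; rewrite mule_ge0 ?lee_fin//; exact: term0.
Qed.

(** Multiplying the density of shape k + alpha by y gives k + alpha times the density of the next
    shape, so Tonelli sums the means. *)
Lemma integral_gweight_gseriesX n C : (forall k, 0 <= n k <= C) ->
  (\int[mu]_(y in Rpos) (y * (gweight y * gseries n y))%:E =
   \sum_(k <oo) ((k%:R + alpha) * n k)%:E)%E.
Proof.
move=> nC; have n0 k : 0 <= n k by have /andP[] := nC k.
transitivity (\int[mu]_(y in Rpos)
    \sum_(k <oo) (((k%:R + alpha) * n k)%:E *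
       (gweight y * (gcoef k.+1 * y ^+ k.+1))%:E))%E.
  apply: eq_integral => y; rewrite inE/= in_itv/= andbT => y0.
  rewrite mulrA EFinM (gseriesE alpha_gt0 (ltW y0) nC) -nneseriesZl//; last first.
    by move=> k _; rewrite lee_fin mulr_ge0// term_ge0// ltW.
  apply: eq_eseriesr => k _; rewrite -!EFinM (gcoef_rec alpha_gt0 k) exprS.
  by congr EFin; ring.
have mterm k : measurable_fun Rpos (fun y : R => (gweight y * (gcoef k * y ^+ k))%:E).
  apply/measurable_EFinP/measurable_funM; first exact: measurable_gweight.
  by apply: measurable_funM => //; exact: measurable_funX.
have term0 k (y : R) : Rpos y -> (0 <= (gweight y * (gcoef k * y ^+ k))%:E)%E.
  rewrite /= in_itv/= andbT => y0.
  by rewrite lee_fin mulr_ge0 ?gweight_ge0// term_ge0// ltW.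
have kn0 k : 0 <= (k%:R + alpha) * n k by rewrite mulr_ge0// ltW.
rewrite integral_nneseries//.
- apply: eq_eseriesr => k _; rewrite ge0_integralZl ?lee_fin//; [|exact: mterm|exact: term0].
  by rewrite integral_gweightX// mule1.
- by move=> k; apply: emeasurable_funM => //; exact: mterm.
- by move=> k y Dy; rewrite mule_ge0 ?lee_fin//; exact: term0.
Qed.

(** Coefficientwise this is (k + alpha) [gcoef k.+1] = [gcoef k]. The vanishing of [n 0] removes the
    head term, whose factor alpha - 1 may be negative. *)
Lemma gseries_shift n C y : 0 <= y -> n 0%N = 0 ->
  (forall k, 0 <= n k <= C) -> (forall k, k%:R * n k <= C) ->
  (alpha - 1) * gseries n y + gseries (fun k => k%:R * n k) y =
  y * gseries (fun k => n k.+1) y.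
Proof.
move=> y0 n0 nC knC.
have nC' k : `|n k| <= C by have /andP[? ?] := nC k; rewrite ger0_norm.
have knC' k : `|k%:R * n k| <= C.
  by rewrite ger0_norm ?knC// mulr_ge0//; have /andP[] := nC k.
have anC k : `|(alpha - 1) * n k| <= `|alpha - 1| * C.
  by rewrite normrM ler_wpM2l.
have nSC k : `|n k.+1| <= C by [].
rewrite (gseriesZ alpha_gt0 _ y0 nC') (gseriesD alpha_gt0 y0 anC knC').
have bC k : `|(alpha - 1) * n k + k%:R * n k| <= `|alpha - 1| * C + C.
  exact: le_trans (ler_normD _ _) (lerD (anC k) (knC' k)).
rewrite {1}/gseries Rintegral_count_recl; last 2 first.
- case=> [|k]; first by rewrite n0 !mulr0 addr0 mul0r.
  rewrite mulr_ge0// ?term_ge0// -mulrDl mulr_ge0//.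
    by rewrite -natr1; have := kalpha_gt0 k; lra.
  by have /andP[] := nC k.+1.
- exact: (integrable_gseries alpha_gt0 y0 bC).
rewrite n0 !mulr0 addr0 mul0r add0r /gseries -RintegralZl//; last first.
  exact: (integrable_gseries alpha_gt0 y0 nSC).
apply: eq_Rintegral => k _; rewrite (gcoef_rec alpha_gt0 k) exprS -natr1; ring.
Qed.

Lemma is_derive_gweight y : 0 < y ->
  is_derive y 1 gweight (((alpha - 1) / y - 1) * gweight y).
Proof.
move=> y0; rewrite (funext (gweightE alpha)); have := is_derive_powR_expRN (alpha - 1) y0.
rewrite (_ : (_ * _ - _) = ((alpha - 1) / y - 1) * (y `^ (alpha - 1) * expR (- y)))//.
rewrite powRB ?(gt_eqF y0) ?implybT// (powRr1 (ltW y0)); ring.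
Qed.

(** A gamma density of shape a + 1 has as derivative the density of shape a minus itself, which
    shifts the weights by one; [n 0 = 0] excludes the shape alpha - 1. *)
Lemma is_derive_gweight_gseries n C y : 0 < y -> n 0%N = 0 ->
  (forall k, 0 <= n k <= C) -> (forall k, k%:R * n k <= C) ->
  is_derive y 1 (fun y => gweight y * gseries n y)
    (gweight y * (gseries (fun k => n k.+1) y - gseries n y)).
Proof.
move=> y0 n0 nC knC.
have nC' k : `|n k| <= C by have /andP[? ?] := nC k; rewrite ger0_norm.
have knC' k : `|k%:R * n k| <= C.
  by rewrite ger0_norm ?knC// mulr_ge0//; have /andP[] := nC k.
have dw := is_derive_gweight y0.
have dS := is_derive_gseries y0 nC' knC'.
apply: is_derive_eq; rewrite /GRing.scale/=.
rewrite (_ : gseries (fun k => n k.+1) y = ((alpha - 1) * gseries n y +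
    gseries (fun k => k%:R * n k) y) / y); last first.
  by rewrite (gseries_shift (ltW y0) n0 nC knC) mulrC mulKf// gt_eqF.
ring.
Qed.

(** Without its head term the series is at most a constant times y e^y, and e^y cancels against the
    weight. This kills the boundary term at 0. *)
Lemma gweight_gseries_le n C y : 0 < y -> n 0%N = 0 ->
  (forall k, 0 <= n k <= C) ->
  gweight y * gseries n y <= C * gcoef 1 * y `^ alpha.
Proof.
move=> y0 n0 nC.
have C0 : 0 <= C by have /andP[h1 h2] := nC 0%N; exact: le_trans h2.
have : gseries n y <= C * gcoef 1 * y * expR y.
  rewrite -lee_fin (gseriesE alpha_gt0 (ltW y0) nC) nneseries_recl_shift; last first.
    by move=> k; rewrite lee_fin mulr_ge0 ?term_ge0 ?(ltW y0)//; have /andP[] := nC k.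
  rewrite n0 mul0r add0e EFinM -eseries_expR ?(ltW y0)// -nneseriesZl; last first.
    by move=> k _; rewrite lee_fin divr_ge0// exprn_ge0// ltW.
  apply: lee_nneseries => [k _ _|k _].
    by rewrite lee_fin mulr_ge0 ?term_ge0 ?(ltW y0)//; have /andP[] := nC k.+1.
  rewrite -EFinM lee_fin exprS.
  rewrite (_ : C * gcoef 1 * y * _ = C * (gcoef 1 / k`!%:R * (y * y ^+ k))); last by ring.
  have yk0 : 0 <= y * y ^+ k by rewrite mulr_ge0 ?exprn_ge0 ?(ltW y0).
  have /andP[? ?] := nC k.+1.
  apply: ler_pM => //; first by rewrite mulr_ge0// ltW// gcoef_gt0.
  by rewrite ler_wpM2r// gcoef_le.
move=> /(ler_wpM2l (gweight_ge0 alpha y)) /le_trans; apply.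
rewrite !gweightE -(mulr_powRB1 (ltW y0) alpha_gt0) expRN.
by rewrite le_eqVlt; apply/orP; left; apply/eqP; field; rewrite gt_eqF// expR_gt0.
Qed.

(** The factor y^2 turns the density of shape k + alpha into (k + alpha)(k + alpha + 1) times the
    density of shape k + alpha + 2, which is at most e by [Gamma_lower_bound]. This kills the
    boundary term at infinity. *)
Lemma gweight_gseries_tail n C K y : 0 < y ->
  (forall k, 0 <= n k <= C) ->
  (\sum_(k <oo) ((k%:R + alpha + 1) * (k%:R + alpha) * n k)%:E <= K%:E)%E ->
  y ^+ 2 * (gweight y * gseries n y) <= expR 1 * K.
Proof.
move=> y0 nC sK; rewrite mulrA -lee_fin EFinM (gseriesE alpha_gt0 (ltW y0) nC).
have k0 k : 0 <= (k%:R + alpha + 1) * (k%:R + alpha) * n k.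
  have := kalpha_gt0 k; have /andP[? ?] := nC k => ?.
  by rewrite !mulr_ge0 ?addr_ge0// ltW.
rewrite -nneseriesZl; last first.
  by move=> k _; rewrite lee_fin mulr_ge0 ?term_ge0 ?(ltW y0)//; have /andP[] := nC k.
rewrite [leRHS]EFinM; apply: (@le_trans _ _ ((expR 1)%:E *
    \sum_(k <oo) ((k%:R + alpha + 1) * (k%:R + alpha) * n k)%:E)%E); last first.
  by apply: lee_wpmul2l => //; rewrite lee_fin expR_ge0.
rewrite -nneseriesZl//; last by move=> k _; rewrite lee_fin.
have w0 := gweight_ge0 alpha y.
apply: lee_nneseries => [k _ _|k _].
  have /andP[? ?] := nC k.
  rewrite -EFinM lee_fin; apply: mulr_ge0; first exact: mulr_ge0 (sqr_ge0 y) w0.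
  by apply: mulr_ge0 => //; exact/term_ge0/ltW.
rewrite -!EFinM lee_fin.
rewrite (_ : y ^+ 2 * _ * _ = n k * gcoef k * (gweight y * y ^+ k.+2)); last first.
  by rewrite !exprS; ring.
rewrite gweightX//.
have /andP[? ?] := nC k.
have a1 : 1 <= k.+2%:R + alpha by rewrite -!natr1; have := kalpha_gt0 k; lra.
have ngc : 0 <= n k * gcoef k by rewrite mulr_ge0// ltW// gcoef_gt0.
apply: le_trans (ler_wpM2l ngc (Gamma_lower_bound a1 y0)) _.
rewrite (_ : k.+2%:R + alpha = k%:R + alpha + 1 + 1); last by rewrite -!natr1; ring.
have ka1 : 0 < k%:R + alpha + 1 by rewrite addr_gt0.
rewrite (GammaS ka1) (GammaS (kalpha_gt0 k)) gcoefE le_eqVlt; apply/orP; left; apply/eqP.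
by field; rewrite gt_eqF// Gamma_gt0.
Qed.

End GammaSeriesCalculus.

(** * Integration by parts against the logarithm of a gamma series *)

Section GammaSeriesEntropy.
Context {R : realType}.
Variable alpha : R.
Hypothesis alpha_gt0 : 0 < alpha.
Local Notation mu := (@lebesgue_measure R).
Local Notation cnt := (@counting nat R).
Local Notation Rpos := (`]0%R, +oo[%classic : set R).
Local Notation gcoef := (gcoef alpha).
Local Notation gweight := (gweight alpha).
Local Notation gseries := (gseries alpha).
Let mRpos : measurable (Rpos : set (measurableTypeR R)).
Proof. exact: measurable_itv. Qed.
Implicit Types (n : nat -> R) (C K x y : R) (k : nat).
Let kalpha_gt0 (k : nat) : 0 < k%:R + alpha.
Proof. by rewrite ltr_wpDl. Qed.
Let term_ge0 k (y : R) : 0 <= y -> 0 <= gcoef k * y ^+ k.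
Proof. by move=> y0; rewrite mulr_ge0 ?exprn_ge0// ltW// gcoef_gt0. Qed.

(** By the mass and mean formulas this only asks for a first moment of the weights. *)
Lemma integrable_gweight_gseries_affine n C K :
  (forall k, 0 <= n k <= C) -> (forall k, k%:R * n k <= C) ->
  (\sum_(k <oo) (k.+1%:R * n k)%:E < +oo)%E ->
  mu.-integrable Rpos
    (fun y => (gweight y * gseries n y * (K + 2 * y))%:E).
Proof.
move=> nC knC fin.
have n0 k : 0 <= n k by have /andP[] := nC k.
have nC' k : `|n k| <= C by have /andP[? ?] := nC k; rewrite ger0_norm.
have knC' k : `|k%:R * n k| <= C by rewrite ger0_norm ?knC// mulr_ge0.
have S0 y : 0 <= y -> 0 <= gweight y * gseries n y.
  by move=> y0; rewrite mulr_ge0 ?gweight_ge0// gseries_ge0.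
have mS : measurable_fun Rpos (fun y => gweight y * gseries n y).
  by apply: measurable_funM; [exact: measurable_gweight|exact: measurable_gseries nC' knC'].
have int0 : mu.-integrable Rpos (fun y => (gweight y * gseries n y)%:E).
  apply/integrableP; split; first exact/measurable_EFinP.
  under eq_integral => y.
    rewrite inE/= in_itv/= andbT => y0; rewrite ger0_norm ?S0 ?(ltW y0)//.
  over.
  rewrite (integral_gweight_gseries alpha_gt0 nC).
  apply: le_lt_trans fin; apply: lee_nneseries => [k _ _|k _]; rewrite lee_fin//.
  by rewrite ler_peMl// ler1n.
have int1 : mu.-integrable Rpos (fun y => (y * (gweight y * gseries n y))%:E).
  apply/integrableP; split; first exact/measurable_EFinP/measurable_funM.
  under eq_integral => y.
    rewrite inE/= in_itv/= andbT => y0.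
    rewrite ger0_norm ?(mulr_ge0 (ltW y0)) ?S0 ?(ltW y0)//.
  over.
  rewrite (integral_gweight_gseriesX alpha_gt0 nC).
  apply: (@le_lt_trans _ _ (\sum_(k <oo) ((1 + alpha)%:E * (k.+1%:R * n k)%:E))%E).
    apply: lee_nneseries => [k _ _|k _]; first by rewrite lee_fin mulr_ge0// ltW.
    have ka0 : 0 <= k%:R * alpha by rewrite mulr_ge0// ltW.
    by rewrite -EFinM lee_fin mulrA ler_wpM2r// -natr1; lra.
  rewrite nneseriesZl; last by move=> k _; rewrite lee_fin mulr_ge0.
  by rewrite lte_mul_pinfty// lee_fin addr_ge0// ltW.
have := integrableD mRpos (integrableZl mRpos K int0) (integrableZl mRpos 2 int1).
apply: eq_integrable => // y _; rewrite /= -!EFinM -EFinD; congr EFin; ring.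
Qed.

(** The series lies between its head term and a constant times e^(2y), so its logarithm grows at
    most linearly in y. *)
Lemma norm_ln_gseries_le n a y : 0 < y -> (forall k, 0 <= n k <= 1) ->
  0 < a <= n 0%N ->
  `|ln (gseries n y) + 1| <=
    `|ln (a * gcoef 0)| + `|ln (gcoef 0 + gcoef 1)| + 1 + 2 * y.
Proof.
move=> y0 n1 /andP[a0 an0].
have g0 := gcoef_gt0 alpha_gt0 0; have g1 := gcoef_gt0 alpha_gt0 1.
have lo : a * gcoef 0 <= gseries n y.
  apply: le_trans (gseries_ge_head alpha_gt0 (ltW y0) n1).
  by rewrite ler_wpM2r// ltW.
have ag0 : 0 < a * gcoef 0 by rewrite mulr_gt0.
have S0 : 0 < gseries n y := lt_le_trans ag0 lo.
have lnlo : ln (a * gcoef 0) <= ln (gseries n y) by rewrite ler_ln ?posrE.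
have lnhi : ln (gseries n y) <= ln (gcoef 0 + gcoef 1) + 2 * y.
  rewrite -[X in _ + X]expRK -lnM ?posrE ?expR_gt0 ?addr_gt0//.
  rewrite ler_ln ?posrE ?mulr_gt0 ?expR_gt0 ?addr_gt0//.
  exact: gseries_le (ltW y0) n1.
have h1 := ler_norm (ln (gcoef 0 + gcoef 1)).
have h2 := ler_norm (- ln (a * gcoef 0)); rewrite normrN in h2.
have h3 := normr_ge0 (ln (gcoef 0 + gcoef 1)).
have h4 := normr_ge0 (ln (a * gcoef 0)).
by rewrite ler_norml; apply/andP; split; lra.
Qed.

Variables (m : nat -> R) (B : R).
Hypothesis m01 : forall k, 0 <= m k <= 1.
Hypothesis m0_gt0 : 0 < m 0%N.
Hypothesis mB : forall k, k%:R ^+ 2 * m k <= B.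
Hypothesis m_fin : (\sum_(k <oo) (k.+1%:R ^+ 3 * m k)%:E < +oo)%E.

(** [n] carries the weights of y F'(y) and [p] is [n] shifted by one, so that by
    [is_derive_gweight_gseries] the derivative of [gweight y * gseries n y] has weights p - n. *)
Let n k := k%:R * m k.
Let p k := k.+1%:R * m k.+1.
Let F := gseries m.
Let L y := ln (F y) + 1.

Let m_ge0 k : 0 <= m k. Proof. by have /andP[] := m01 k. Qed.
Let n0 : n 0%N = 0. Proof. by rewrite /n mul0r. Qed.
Let n_ge0 k : 0 <= n k. Proof. by rewrite mulr_ge0. Qed.
Let p_ge0 k : 0 <= p k. Proof. by rewrite mulr_ge0. Qed.
Let knB k : k%:R * n k <= B. Proof. by rewrite /n mulrA -expr2. Qed.
Let nB k : 0 <= n k <= B.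
Proof.
rewrite n_ge0/=; case: k => [|k]; first by rewrite n0 (le_trans _ (mB 0))// mulr_ge0.
by apply: le_trans (knB k.+1); rewrite ler_peMl// ler1n.
Qed.
Let pB k : 0 <= p k <= B. Proof. exact: nB. Qed.
Let kpB k : k%:R * p k <= B.
Proof. by apply: le_trans (knB k.+1); rewrite ler_wpM2r// ler_nat. Qed.
Let B_ge0 : 0 <= B. Proof. by have /andP[h1 h2] := nB 0; exact: le_trans h2. Qed.

Let norm_ub (q : nat -> R) C : (forall k, 0 <= q k <= C) -> forall k, `|q k| <= C.
Proof. by move=> qC k; have /andP[? ?] := qC k; rewrite ger0_norm. Qed.
Let norm_kub (q : nat -> R) C C' : (forall k, 0 <= q k <= C) ->
  (forall k, k%:R * q k <= C') -> forall k, `|k%:R * q k| <= C'.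
Proof.
by move=> qC kqC k; have /andP[? ?] := qC k; rewrite ger0_norm// mulr_ge0.
Qed.

Let mle k : `|m k| <= 1 + B.
Proof. by apply: le_trans (norm_ub m01 k) _; rewrite lerDl. Qed.
Let kmle k : `|k%:R * m k| <= 1 + B.
Proof. by apply: le_trans (norm_ub nB k) _; rewrite lerDr. Qed.

Let F_gt0 y : 0 < y -> 0 < F y.
Proof.
move=> y0; apply: lt_le_trans (gseries_ge_head alpha_gt0 (ltW y0) m01).
by rewrite mulr_gt0// gcoef_gt0.
Qed.

Lemma is_derive_ln_gseries y : 0 < y ->
  is_derive y 1 (fun y => ln (gseries m y)) (gseries n y / (y * gseries m y)).
Proof.
move=> y0; have dF := is_derive_gseries alpha_gt0 y0 mle kmle.
have dln := is_derive1_ln (F_gt0 y0).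
rewrite (_ : _ / _ = (F y)^-1 * (gseries n y / y)); first exact: (is_derive1_comp dln dF).
by rewrite invfM; ring.
Qed.

Let contF y : 0 < y -> {for y, continuous F}.
Proof. by move=> y0; exact: continuous_gseries mle kmle. Qed.
Let contn y : 0 < y -> {for y, continuous (gseries n)}.
Proof. by move=> y0; exact: continuous_gseries (norm_ub nB) (norm_kub nB knB). Qed.
Let contp y : 0 < y -> {for y, continuous (gseries p)}.
Proof. by move=> y0; exact: continuous_gseries (norm_ub pB) (norm_kub pB kpB). Qed.
Let contw y : 0 < y -> {for y, continuous gweight}.
Proof.
move=> y0; apply/differentiable_continuous/derivable1_diffP.
by have [] := is_derive_gweight alpha y0.
Qed.
Let contL y : 0 < y -> {for y, continuous L}.
Proof.
move=> y0; apply: continuousD; last exact: cst_continuous.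
by apply: continuous_comp; [exact: contF|apply: continuous_ln; exact: F_gt0].
Qed.

Let fin_np : (\sum_(k <oo) (k.+1%:R * (p k + n k))%:E < +oo)%E.
Proof.
have m3 k : 0 <= k.+1%:R ^+ 3 * m k by rewrite mulr_ge0// exprn_ge0.
have finS : (\sum_(k <oo) (k.+2%:R ^+ 3 * m k.+1)%:E < +oo)%E.
  apply: le_lt_trans m_fin.
  rewrite (@nneseries_recl_shift _ (fun k => (k.+1%:R ^+ 3 * m k)%:E)).
    by rewrite leeDr// lee_fin.
  by move=> k; rewrite lee_fin.
apply: (@le_lt_trans _ _ (\sum_(k <oo) ((k.+2%:R ^+ 3 * m k.+1)%:E +
    (k.+1%:R ^+ 3 * m k)%:E))%E); last first.
  by rewrite nneseriesD ?lte_add_pinfty// => k _ _; rewrite lee_fin.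
have k1 k : 1 <= k.+1%:R :> R by rewrite ler1n.
apply: lee_nneseries => [k _ _|k _].
  by rewrite lee_fin mulr_ge0// addr_ge0.
rewrite -EFinD lee_fin mulrDr lerD//.
  rewrite /p mulrA ler_wpM2r// -expr2 (le_trans _ (_ : k.+2%:R ^+ 2 <= _))//.
    by rewrite lerXn2r ?nnegrE// ler_nat.
  by rewrite ler_eXn2l// ltr1n.
rewrite /n mulrA ler_wpM2r// (@le_trans _ _ (k.+1%:R ^+ 2))//.
  by rewrite expr2 ler_wpM2l// ler_nat.
by rewrite [leRHS]exprS ler_peMl// exprn_ge0.
Qed.

Let K0 := `|ln (m 0%N * gcoef 0)| + `|ln (gcoef 0 + gcoef 1)| + 1.
Let normL y : 0 < y -> `|L y| <= K0 + 2 * y.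
Proof. by move=> y0; apply: norm_ln_gseries_le => //; rewrite m0_gt0/=. Qed.
Let K0_ge0 : 0 <= K0.
Proof. by rewrite !addr_ge0. Qed.

(** Integrable majorant of [dA y * L y]; added to both sides in [balance] it supplies the signs
    required by [ge0_integral_derive_diff]. *)
Let G y := gweight y * gseries (fun k => p k + n k) y * (K0 + 2 * y).
Let intG : mu.-integrable Rpos (EFin \o G).
Proof.
apply: (@integrable_gweight_gseries_affine _ (B + B)) => //.
- by move=> k; rewrite addr_ge0//= lerD//; [have /andP[] := pB k|have /andP[] := nB k].
- by move=> k; rewrite mulrDr lerD.
Qed.

Let GE y : 0 < y -> G y = gweight y * (gseries p y + gseries n y) * (K0 + 2 * y).
Proof.
by move=> y0; rewrite (gseriesD alpha_gt0 (ltW y0) (norm_ub pB) (norm_ub nB)).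
Qed.

Let dA y := gweight y * (gseries p y - gseries n y).
Let Q y := gweight y * gseries n y ^+ 2 / (y * F y).

Let dAL_G y : 0 < y -> `|dA y * L y| <= G y.
Proof.
move=> y0; rewrite GE// normrM; apply: ler_pM => //; last exact: normL.
rewrite /dA normrM (ger0_norm (gweight_ge0 _ _)).
rewrite ler_wpM2l ?gweight_ge0// (le_trans (ler_normB _ _))//.
by rewrite !ger0_norm ?gseries_ge0// ltW.
Qed.

(** Near 0 the product is at most a constant times y^alpha (K0 + 2y). *)
Let cvg_H0 : (gweight y * gseries n y * L y) @[y --> 0^'+] --> (0 : R).
Proof.
apply: norm_cvg0.
apply: (@squeeze_cvgr _ _ _ _ (cst 0) (fun y => B * gcoef 1 * y `^ alpha * (K0 + 2 * y))).
- near=> y; rewrite normr_ge0/=.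
  have y0 : 0 < y by near: y; exact: nbhs_right_gt.
  rewrite normrM; apply: ler_pM => //; last exact: normL.
  rewrite ger0_norm ?mulr_ge0 ?gweight_ge0 ?gseries_ge0 ?(ltW y0)//.
  exact: (gweight_gseries_le alpha_gt0 y0 n0 nB).
- exact: cvg_cst.
- rewrite -[X in _ --> X](mul0r (K0 + 2 * 0)); apply: cvgM.
    rewrite -[X in _ --> X](mulr0 (B * gcoef 1)); apply: cvgMr.
    exact: powR_cvg0.
  apply: cvg_at_right_filter; apply: cvgD; first exact: cvg_cst.
  by apply: cvgMr; exact: cvg_id.
Unshelve. all: end_near. Qed.

Let tail_fin : exists K, (\sum_(k <oo) ((k%:R + alpha + 1) * (k%:R + alpha) * n k)%:E <= K%:E)%E.
Proof.
have m3 k : 0 <= k.+1%:R ^+ 3 * m k by rewrite mulr_ge0// exprn_ge0.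
have tm k : 0 <= (k%:R + alpha + 1) * (k%:R + alpha) * n k.
  by rewrite mulr_ge0// mulr_ge0 ?addr_ge0// ltW.
have : (\sum_(k <oo) ((k%:R + alpha + 1) * (k%:R + alpha) * n k)%:E < +oo)%E.
  apply: (@le_lt_trans _ _ (\sum_(k <oo)
      (((1 + alpha) ^+ 2)%:E * (k.+1%:R ^+ 3 * m k)%:E))%E); last first.
    rewrite nneseriesZl; last by move=> k _; rewrite lee_fin.
    by rewrite lte_mul_pinfty// lee_fin sqr_ge0.
  apply: lee_nneseries => [k _ _|k _]; rewrite -?EFinM lee_fin//.
  have ka0 : 0 <= k%:R * alpha by rewrite mulr_ge0// ltW.
  have k0 := ler0n R k.
  rewrite /n mulrA mulrA ler_wpM2r//.
  rewrite (_ : (1 + alpha) ^+ 2 * _ = ((1 + alpha) * k.+1%:R) ^+ 2 * k.+1%:R); last by ring.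
  apply: ler_pM => //.
  - by rewrite mulr_ge0 ?addr_ge0// ltW.
  - have e0 := ltW (kalpha_gt0 k).
    have e1 : k%:R + alpha + 1 <= (1 + alpha) * k.+1%:R by rewrite -natr1; lra.
    have e2 : k%:R + alpha <= (1 + alpha) * k.+1%:R by lra.
    by rewrite expr2; apply: ler_pM => //; rewrite addr_ge0.
  - by rewrite ler_nat.
exists (fine (\sum_(k <oo) ((k%:R + alpha + 1) * (k%:R + alpha) * n k)%:E)%E).
by rewrite fineK// ge0_fin_numE// nneseries_ge0// => k _ _; rewrite lee_fin.
Qed.

(** Decay of order y^-2 against linear growth of the logarithm leaves 1/y. *)
Let cvg_Hy : (gweight y * gseries n y * L y) @[y --> +oo] --> (0 : R).
Proof.
have [K hK] := tail_fin.
apply: norm_cvg0.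
apply: (@squeeze_cvgr _ _ _ _ (cst 0) (fun y => expR 1 * K * (K0 + 2) * y^-1)).
- near=> y; rewrite normr_ge0/=.
  have y1 : 1 <= y by near: y; exact: nbhs_pinfty_ge.
  have y0 : 0 < y := lt_le_trans ltr01 y1.
  have A0 : 0 <= gweight y * gseries n y.
    by rewrite mulr_ge0 ?gweight_ge0 ?gseries_ge0// ltW.
  have := gweight_gseries_tail alpha_gt0 y0 nB hK.
  rewrite -ler_pdivlMl ?exprn_gt0// => hA.
  have hL : `|L y| <= (K0 + 2) * y.
    apply: le_trans (normL y0) _; rewrite (mulrDl K0 2 y); apply: lerD => //.
    by rewrite ler_peMr.
  rewrite normrM (ger0_norm A0).
  apply: le_trans (ler_pM A0 (normr_ge0 _) hA hL) _.
  by rewrite le_eqVlt; apply/orP; left; apply/eqP; field; rewrite gt_eqF.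
- exact: cvg_cst.
- rewrite -[X in _ --> X](mulr0 (expR 1 * K * (K0 + 2))); apply: cvgMr.
  apply/(@gtr0_cvgV0 _ _ _ _ id); last exact: cvg_id.
  by near=> y; near: y; exact: nbhs_pinfty_gt.
Unshelve. all: end_near. Qed.

Let Q_ge0 y : 0 < y -> 0 <= Q y.
Proof.
move=> y0; rewrite /Q; apply: mulr_ge0.
  by apply: mulr_ge0; [exact: gweight_ge0|exact: sqr_ge0].
by rewrite invr_ge0; apply: mulr_ge0; apply: ltW => //; exact: F_gt0.
Qed.

Let contQ y : 0 < y -> {for y, continuous Q}.
Proof.
move=> y0; apply: continuousM.
  apply: continuousM; first exact: contw.
  by apply: (@continuousM _ _ (gseries n) (gseries n)); exact: contn.
apply: continuousV; first by rewrite mulf_neq0// gt_eqF// F_gt0.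
by apply: continuousM; [exact: cvg_id|exact: contF].
Qed.

Let contdA y : 0 < y -> {for y, continuous dA}.
Proof.
move=> y0; apply: continuousM; first exact: contw.
by apply: continuousB; [exact: contp|exact: contn].
Qed.

Let contG y : 0 < y -> {for y, continuous G}.
Proof.
move=> y0; apply: continuousM.
  apply: continuousM; first exact: contw.
  have b1 k : `|p k + n k| <= B + B.
    by rewrite ger0_norm ?addr_ge0// lerD//; [have /andP[] := pB k|have /andP[] := nB k].
  have b2 k : `|k%:R * (p k + n k)| <= B + B.
    by rewrite ger0_norm ?mulr_ge0 ?addr_ge0// mulrDr lerD.
  exact: continuous_gseries b1 b2.
by apply: continuousD; [exact: cst_continuous|apply: continuousM; [exact: cst_continuous|exact: cvg_id]].
Qed.

Let contAL y : 0 < y -> {for y, continuous (fun y => dA y * L y)}.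
Proof. by move=> y0; apply: continuousM; [exact: contdA|exact: contL]. Qed.

Let mcont (f : R -> R) : (forall y, 0 < y -> {for y, continuous f}) ->
  measurable_fun Rpos f.
Proof.
move=> cf; apply: open_continuous_measurable_fun; first exact: interval_open.
by move=> y; rewrite inE/= in_itv/= andbT; exact: cf.
Qed.

Let intAL : mu.-integrable Rpos (EFin \o (fun y => dA y * L y)).
Proof.
apply: le_integrable intG => //; first by apply/measurable_EFinP; exact: mcont contAL.
move=> y /=; rewrite in_itv/= andbT => y0.
by rewrite lee_fin (le_trans (dAL_G y0))// ler_norm.
Qed.

(** Product rule for A L with A = w S, S the series of [n]: since L' = S/(yF), the derivative is
    [dA * L + Q], and [G] is added to make both parts nonnegative. *)
Let balance : (\int[mu]_(y in Rpos) (dA y * L y + G y + Q y)%:E =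
               \int[mu]_(y in Rpos) (G y)%:E)%E.
Proof.
have AL0 y : 0 < y -> 0 <= dA y * L y + G y.
  by move=> y0; have := dAL_G y0; rewrite ler_norml => /andP[? _]; lra.
apply: (@ge0_integral_derive_diff _ (fun y => gweight y * gseries n y * L y)).
- by move=> y y0; rewrite addr_ge0 ?AL0 ?Q_ge0.
- by move=> y y0; apply: le_trans (dAL_G y0).
- move=> y y0; apply: continuousD; last exact: contQ.
  by apply: continuousD; [exact: contAL|exact: contG].
- exact: contG.
- move=> y y0.
  have d1 := is_derive_gweight_gseries alpha_gt0 y0 n0 nB knB.
  have d2 := is_derive_ln_gseries y0.
  apply: is_derive_eq; rewrite /GRing.scale/= addr0 /dA /Q /L; ring.
- exact: cvg_H0.
- exact: cvg_Hy.
Qed.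

(** In [balance] both [dA * L + G] and [Q] are nonnegative and sum to the finite integral of [G].
    Hence the Fisher-type integrand [Q] is integrable as a consequence, and cancelling [G] gives the
    formula. *)
Lemma gseries_integration_by_parts :
  [/\ mu.-integrable Rpos (fun y => (gweight y * (gseries p y - gseries n y) *
        (ln (gseries m y) + 1))%:E),
      mu.-integrable Rpos (fun y => (gweight y * gseries n y ^+ 2 /
        (y * gseries m y))%:E) &
      \int[mu]_(y in Rpos) (gweight y * (gseries p y - gseries n y) *
        (ln (gseries m y) + 1)) =
      - \int[mu]_(y in Rpos) (gweight y * gseries n y ^+ 2 / (y * gseries m y))].
Proof.
have mALG : measurable_fun Rpos (fun y => (dA y * L y + G y)%:E).
  apply/measurable_EFinP/measurable_funD; apply: mcont => y y0.
    exact: contAL.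
  exact: contG.
have mQ : measurable_fun Rpos (EFin \o Q) by apply/measurable_EFinP; exact: mcont contQ.
have AL0 y : 0 < y -> 0 <= dA y * L y + G y.
  by move=> y0; have := dAL_G y0; rewrite ler_norml => /andP[? _]; lra.
have bal : (\int[mu]_(y in Rpos) (dA y * L y + G y)%:E +
    \int[mu]_(y in Rpos) (Q y)%:E = \int[mu]_(y in Rpos) (G y)%:E)%E.
  rewrite -balance -ge0_integralD//=.
  - by move=> y; rewrite in_itv/= andbT => y0; rewrite lee_fin AL0.
  - by move=> y; rewrite in_itv/= andbT => y0; rewrite lee_fin Q_ge0.
have finG := integrable_fin_num mRpos intG.
have finALG := integrable_fin_num mRpos (integrableD mRpos intAL intG).
have finQ : (\int[mu]_(y in Rpos) (Q y)%:E < +oo)%E.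
  apply: (@le_lt_trans _ _ (\int[mu]_(y in Rpos) (G y)%:E)%E).
    rewrite -bal leeDr// integral_ge0// => y /=.
    by rewrite in_itv/= andbT => y0; rewrite lee_fin AL0.
  exact: (integrable_lty mRpos intG).
have intQ : mu.-integrable Rpos (EFin \o Q).
  apply/integrableP; split => //.
  under eq_integral => y.
    rewrite inE/= in_itv/= andbT => y0; rewrite ger0_norm ?Q_ge0//.
  over.
  exact: finQ.
split => //.
have := congr1 fine bal; rewrite fineD//; last exact: (integrable_fin_num mRpos intQ).
rewrite -/(Rintegral mu Rpos (fun y => dA y * L y + G y)).
rewrite RintegralD//.
rewrite -[X in X -> _]/(Rintegral mu Rpos (fun y => dA y * L y) +
  Rintegral mu Rpos G + Rintegral mu Rpos Q = Rintegral mu Rpos G).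
by rewrite /dA /L /Q /F; lra.
Qed.

End GammaSeriesEntropy.

(** * Poisson weights: recurrence, moments, polynomial decay *)

HB.lock Definition poisson (R : realType) (k : nat) (z : R) : R :=
  expR (- z) * (z ^+ k / k`!%:R).

Section PoissonWeights.
Context {R : realType}.
Implicit Types (c x z : R) (k : nat).
Local Notation Rpos := (`]0%R, +oo[%classic : set R).

Lemma poissonE k z : poisson k z = expR (- z) * (z ^+ k / k`!%:R).
Proof. by rewrite unlock. Qed.

Lemma poisson_ge0 k z : 0 <= z -> 0 <= poisson k z.
Proof. by move=> z0; rewrite poissonE mulr_ge0 ?expR_ge0// divr_ge0// exprn_ge0. Qed.

Lemma poisson_le1 k z : 0 <= z -> poisson k z <= 1.
Proof.
move=> z0; rewrite !poissonE expRN ler_pdivrMl ?expR_gt0// mulr1; case: k => [|k].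
  by rewrite fact0 divr1 expr0 (le_trans _ (expR_ge1Dx z))// lerDl.
by apply: le_trans (expR_ge1Dxn k z0); rewrite lerDr.
Qed.

Lemma mul_poisson k z : z * poisson k z = k.+1%:R * poisson k.+1 z.
Proof.
rewrite !poissonE exprS factS natrM invfM.
have : k.+1%:R != 0 :> R by rewrite pnatr_eq0.
move: k.+1%:R (k`!%:R^-1) => t r t0.
rewrite [RHS](_ : _ = (t * t^-1) * (z * (expR (- z) * (z ^+ k * r)))); last by ring.
by rewrite mulfV// mul1r.
Qed.

Lemma eseries_poisson_mul (f : nat -> R) z : 0 <= z -> (forall k, 0 <= f k) ->
  (\sum_(k <oo) (k%:R * f k * poisson k z)%:E =
   z%:E * \sum_(k <oo) (f k.+1 * poisson k z)%:E)%E.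
Proof.
move=> z0 f0.
rewrite nneseries_recl_shift; last first.
  by move=> k; rewrite lee_fin !mulr_ge0// poisson_ge0.
rewrite !mul0r add0e -nneseriesZl; last first.
  by move=> k _; rewrite lee_fin mulr_ge0// poisson_ge0.
apply: eq_eseriesr => k _; rewrite -EFinM; congr EFin.
by rewrite mulrCA mul_poisson; ring.
Qed.

Lemma eseries_poisson z : 0 <= z -> (\sum_(k <oo) (poisson k z)%:E = 1)%E.
Proof.
move=> z0; under eq_eseriesr do rewrite poissonE EFinM.
rewrite nneseriesZl; last by move=> k _; rewrite lee_fin divr_ge0// exprn_ge0.
by rewrite eseries_expR// -EFinM -expRD addNr expR0.
Qed.

Lemma eseries_poisson_mean z : 0 <= z ->
  (\sum_(k <oo) (k%:R * poisson k z)%:E = z%:E)%E.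
Proof.
move=> z0; have := @eseries_poisson_mul (fun=> 1) z z0 (fun=> ler01).
under eq_eseriesr do rewrite mulr1.
by move=> ->; under eq_eseriesr do rewrite mul1r; rewrite eseries_poisson// mule1.
Qed.

(** Use (k+1)^(j+1) <= 1 + a k^(j+1) with a = 2^(j+1) - 1, that is 3 and then 7, and trade one
    factor k for z by shifting the index. *)
Lemma eseries_poisson_cube_le z : 0 <= z ->
  (\sum_(k <oo) (k.+1%:R ^+ 3 * poisson k z)%:E <=
   (1 + 7 * (z * (1 + 3 * (z * (z + 1)))))%:E)%E.
Proof.
move=> z0.
have p0 k := poisson_ge0 k z0.
have s1 : (\sum_(k <oo) (k.+1%:R * poisson k z)%:E = (z + 1)%:E)%E.
  rewrite EFinD -[in RHS](eseries_poisson_mean z0) -(eseries_poisson z0).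
  rewrite -nneseriesD; [|by move=> k _ _; rewrite lee_fin mulr_ge0|by move=> k _ _; rewrite lee_fin].
  by apply: eq_eseriesr => k _; rewrite -EFinD -natr1 mulrDl mul1r.
have step j (a b : R) : 0 <= a -> 0 <= b ->
    (forall k, k.+1%:R ^+ j.+1 <= 1 + a * (k%:R * k%:R ^+ j) :> R) ->
    (\sum_(k <oo) (k.+1%:R ^+ j * poisson k z)%:E <= b%:E)%E ->
    (\sum_(k <oo) (k.+1%:R ^+ j.+1 * poisson k z)%:E <= (1 + a * (z * b))%:E)%E.
  move=> a0 b0 ha hb.
  apply: (@le_trans _ _ (\sum_(k <oo) ((poisson k z)%:E +
      a%:E * (k%:R * k%:R ^+ j * poisson k z)%:E))%E).
    apply: lee_nneseries => [k _ _|k _].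
      by rewrite lee_fin mulr_ge0// exprn_ge0.
    rewrite -EFinM -EFinD lee_fin mulrA -[X in _ <= X + _]mul1r -mulrDl.
    by rewrite ler_wpM2r.
  have kj0 k : 0 <= k%:R * k%:R ^+ j * poisson k z.
    by rewrite !mulr_ge0// exprn_ge0.
  rewrite nneseriesD; [|by move=> k _ _; rewrite lee_fin|
    by move=> k _ _; rewrite -EFinM lee_fin mulr_ge0].
  rewrite nneseriesZl; last by move=> k _; rewrite lee_fin.
  rewrite eseries_poisson// (@eseries_poisson_mul (fun k => k%:R ^+ j))//.
  rewrite EFinD EFinM EFinM leeD2l//.
  by rewrite !lee_wpmul2l// ?lee_fin.
have z1 : 0 <= z + 1 by rewrite addr_ge0.
have s2 := @step 1 3 (z + 1) _ z1.
apply: (@step 2) => //.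
- by rewrite addr_ge0// mulr_ge0// mulr_ge0.
- move=> k; have := ler0n R k; rewrite -natr1.
  case: k => [|k]; first by rewrite !mul0r; lra.
  have : 1 <= k.+1%:R :> R by rewrite ler1n.
  by move: (k.+1%:R) => t t1 t0; rewrite !exprS !expr0; nra.
- apply: s2 => //.
  + move=> k; have := ler0n R k; rewrite -natr1.
    case: k => [|k]; first by rewrite !mul0r; lra.
    have : 1 <= k.+1%:R :> R by rewrite ler1n.
    by move: (k.+1%:R) => t t1 t0; rewrite !exprS !expr0; nra.
  + by under eq_eseriesr do rewrite expr1; rewrite s1.
Qed.

(** For k < 4 the power is at most 256. For k >= 4, k + 1 is at most 5 times each of k, k-1, k-2,
    k-3, whence 625 = 5^4, and this falling factorial times the k-th weight is z^4 times the
    (k-4)-th weight. *)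
Lemma poisson_pow4_le k z : 0 <= z ->
  k.+1%:R ^+ 4 * poisson k z <= 625 * (1 + z ^+ 4).
Proof.
move=> z0; have p0 := poisson_ge0 k z0; have p1 := poisson_le1 k z0.
have z4 : 0 <= z ^+ 4 by rewrite exprn_ge0.
case: (ltnP k 4) => k4.
  have k5 : k.+1%:R <= 4 :> R by rewrite ler_nat.
  have : k.+1%:R ^+ 4 <= 256 :> R.
    rewrite (_ : 256 = 4 ^+ 4); last by rewrite -natrX.
    by rewrite lerXn2r ?nnegrE.
  have : 0 <= k.+1%:R ^+ 4 :> R by rewrite exprn_ge0.
  by move: (k.+1%:R ^+ 4) => a a0 ha; nra.
have [j kj] : exists j, k = j.+4 by exists (k - 4)%N; lia.
rewrite kj in p0 p1 *.
have pj1 := poisson_le1 j z0; have pj0 := poisson_ge0 j z0.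
have E : z ^+ 4 * poisson j z =
    j.+1%:R * j.+2%:R * j.+3%:R * j.+4%:R * poisson j.+4 z.
  rewrite (_ : z ^+ 4 * _ = z ^+ 3 * (z * poisson j z)); last by ring.
  rewrite mul_poisson (_ : _ * _ = j.+1%:R * z ^+ 2 * (z * poisson j.+1 z)); last by ring.
  rewrite mul_poisson (_ : _ * _ = j.+1%:R * j.+2%:R * z * (z * poisson j.+2 z)); last by ring.
  rewrite mul_poisson (_ : _ * _ = j.+1%:R * j.+2%:R * j.+3%:R * (z * poisson j.+3 z)); last by ring.
  by rewrite mul_poisson; ring.
have t0 : 0 <= j%:R :> R by [].
have : j.+4.+1%:R ^+ 4 <= 625 * (j.+1%:R * j.+2%:R * j.+3%:R * j.+4%:R) :> R.
  rewrite (_ : 625 = 5 * 5 * 5 * 5); last by rewrite -!natrM.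
  rewrite (_ : _ * (_ * _ * _ * _) = (5 * j.+1%:R) * (5 * j.+2%:R) * (5 * j.+3%:R) * (5 * j.+4%:R)); last by ring.
  rewrite (_ : j.+4.+1%:R ^+ 4 = j.+4.+1%:R * j.+4.+1%:R * j.+4.+1%:R * j.+4.+1%:R); last by ring.
  by apply: ler_pM => //; [apply: ler_pM => //; [apply: ler_pM => //|]|]; rewrite -natrM ler_nat; lia.
move=> /(ler_wpM2r p0) /le_trans; apply.
rewrite -(mulrA 625) -E; apply: ler_wpM2l; first exact: ler0n.
by apply: le_trans (_ : z ^+ 4 * 1 <= _); [rewrite ler_wpM2l|rewrite mulr1 lerDr].
Qed.

End PoissonWeights.

(** * Mixed Poisson weights *)

Section PoissonMixture.
Context {R : realType}.
Implicit Types (c x z : R) (k : nat).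
Local Notation Rpos := (`]0%R, +oo[%classic : set R).
Lemma is_derive_poisson k z :
  is_derive z 1 (poisson k : R -> R) ((if k is j.+1 then poisson j z else 0) - poisson k z).
Proof.
rewrite (_ : poisson k = (fun z => expR (- z) * (z ^+ k / k`!%:R))); last first.
  by apply/funext => y; rewrite poissonE.
have de : is_derive z 1 (fun t : R => expR (- t)) (- expR (- z)).
  by apply: is_derive_eq; rewrite /GRing.scale/=; ring.
have dx : is_derive z 1 (fun t : R => t ^+ k) (k%:R * z ^+ k.-1).
  by apply: DeriveDef; [exact: exprn_derivable|rewrite exp_derive/GRing.scale/= mulr1].
apply: is_derive_eq; rewrite /GRing.scale/=.
case: k dx => [|j] _; first by rewrite mul0r; ring.
rewrite poissonE/= factS natrM exprS.
have j0 : j.+1%:R != 0 :> R by rewrite pnatr_eq0.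
have f0 : j`!%:R != 0 :> R by rewrite pnatr_eq0 gtn_eqF// fact_gt0.
move: j.+1%:R j`!%:R j0 f0 => t r t0 r0.
by field; rewrite t0 r0.
Qed.

Variable Q : probability R R.
Hypothesis Q1 : Q Rpos = 1%E.
Hypothesis Q4 : (\int[Q]_(x in Rpos) (x ^+ 4)%:E < +oo)%E.

(** For c = lam tau/(1 - tau) these are the probabilities of the mixing index K of the smart
    path. *)
Definition pmix k c : R := \int[Q]_(x in Rpos) poisson k (c * x).
Definition pmoment (j : nat) : R := \int[Q]_(x in Rpos) x ^+ j.

Let mRpos : measurable Rpos. Proof. exact: measurable_itv. Qed.

Let RposE x : Rpos x -> 0 < x. Proof. by rewrite /= in_itv/= andbT. Qed.

Lemma measurable_poisson_scale k c : measurable_fun Rpos (fun x : R => poisson k (c * x)).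
Proof.
apply: (@measurableT_comp _ _ _ _ _ _ (poisson k)); last exact: measurable_funM.
apply: continuous_measurable_fun => z.
apply/differentiable_continuous/derivable1_diffP.
by have [] := is_derive_poisson k z.
Qed.

Let integrable_cst (r : R) : Q.-integrable Rpos (EFin \o cst r).
Proof. exact: finite_measure_integrable_cst. Qed.

Lemma integrable_poisson k c : 0 <= c ->
  Q.-integrable Rpos (EFin \o (fun x => poisson k (c * x))).
Proof.
move=> c0; apply: (le_integrable mRpos _ _ (integrable_cst 1)).
  by apply/measurable_EFinP; exact: measurable_poisson_scale.
move=> x /RposE x0 /=; have cx0 : 0 <= c * x by rewrite mulr_ge0// ltW.
by rewrite lee_fin normr1 ger0_norm ?poisson_ge0// poisson_le1.
Qed.

Lemma pmixE k c : 0 <= c ->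
  ((pmix k c)%:E = \int[Q]_(x in Rpos) (poisson k (c * x))%:E)%E.
Proof.
by move=> c0; rewrite /pmix /Rintegral fineK//; exact/integrable_fin_num/integrable_poisson.
Qed.

Lemma pmix_ge0 k c : 0 <= c -> 0 <= pmix k c.
Proof.
by move=> c0; apply: Rintegral_ge0 => x /RposE x0; rewrite poisson_ge0// mulr_ge0// ltW.
Qed.

Lemma pmix_le1 k c : 0 <= c -> pmix k c <= 1.
Proof.
move=> c0; rewrite -lee_fin pmixE//.
apply: (@le_trans _ _ (\int[Q]_(x in Rpos) 1)%E); last by rewrite integral_cst// mul1e probability_le1.
apply: ge0_le_integral => //.
- by move=> x /RposE x0; rewrite lee_fin poisson_ge0// mulr_ge0// ltW.
- by apply/measurable_EFinP; exact: measurable_poisson_scale.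
- by move=> x /RposE x0; rewrite lee_fin poisson_le1// mulr_ge0// ltW.
Qed.

Lemma integrable_pmoment j : (j <= 4)%N -> Q.-integrable Rpos (fun x => (x ^+ j)%:E).
Proof.
move=> j4.
have int4 : Q.-integrable Rpos (fun x => (x ^+ 4)%:E).
  apply/integrableP; split; first exact/measurable_EFinP/measurable_funX.
  under eq_integral => x.
    rewrite inE => /RposE x0; rewrite gee0_abs ?lee_fin ?exprn_ge0 ?(ltW x0)//.
  over.
  exact: Q4.
have := integrableD mRpos (integrable_cst 1) int4.
apply: le_integrable => //; first exact/measurable_EFinP/measurable_funX.
move=> x /RposE x0; rewrite /= lee_fin.
rewrite !ger0_norm ?addr_ge0 ?exprn_ge0 ?(ltW x0)//.
case: (lerP x 1) => x1.
  by rewrite (@le_trans _ _ 1)// ?exprn_ile1 ?(ltW x0)// lerDl exprn_ge0// ltW.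
by rewrite (@le_trans _ _ (x ^+ 4))// ?ler_weXn2l ?(ltW x1)// lerDr.
Qed.

Lemma pmomentE j : (j <= 4)%N ->
  ((pmoment j)%:E = \int[Q]_(x in Rpos) (x ^+ j)%:E)%E.
Proof.
move=> j4; rewrite /pmoment /Rintegral fineK//.
exact/integrable_fin_num/integrable_pmoment.
Qed.

Lemma pmoment_ge0 j : 0 <= pmoment j.
Proof. by apply: Rintegral_ge0 => x /RposE x0; rewrite exprn_ge0// ltW. Qed.

(** The fourth moment of X becomes decay of order k^-4 of the weights, with a constant that is
    monotone in c. *)
Lemma pmix_pow4_le k c : 0 <= c ->
  k.+1%:R ^+ 4 * pmix k c <= 625 * (1 + c ^+ 4 * pmoment 4).
Proof.
move=> c0; have k0 : 0 <= k.+1%:R ^+ 4 :> R by rewrite exprn_ge0.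
have i4 := integrable_pmoment (leqnn 4).
have ip := integrable_poisson k c0.
rewrite /pmix /pmoment -RintegralZl// -RintegralZl//.
have one : \int[Q]_(x in Rpos) cst 1 x = 1.
  by transitivity (1 * fine (Q Rpos)); [rewrite Rintegral_cst|rewrite Q1 mulr1].
rewrite -[X in 625 * (X + _)]one.
rewrite -RintegralD//; last exact: (integrableZl mRpos (c ^+ 4) i4).
rewrite -RintegralZl//; last first.
  exact: (integrableD mRpos (integrable_cst 1) (integrableZl mRpos (c ^+ 4) i4)).
apply: le_Rintegral => //.
- exact: (integrableZl mRpos _ ip).
- exact: (integrableZl mRpos _ (integrableD mRpos (integrable_cst 1) (integrableZl mRpos (c ^+ 4) i4))).
- move=> x /RposE x0; rewrite /= -(exprMn 4 c x); apply: poisson_pow4_le.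
  by rewrite mulr_ge0// ltW.
Qed.

Lemma eseries_pmix (f : nat -> R) c : 0 <= c -> (forall k, 0 <= f k) ->
  (\sum_(k <oo) (f k * pmix k c)%:E =
   \int[Q]_(x in Rpos) \sum_(k <oo) (f k * poisson k (c * x))%:E)%E.
Proof.
move=> c0 f0; rewrite integral_nneseries//.
- apply: eq_eseriesr => k _; rewrite EFinM pmixE// -ge0_integralZl//.
  + by apply/measurable_EFinP; exact: measurable_poisson_scale.
  + by move=> x /RposE x0; rewrite lee_fin poisson_ge0// mulr_ge0// ltW.
  + by rewrite lee_fin.
- by move=> k; apply/measurable_EFinP/measurable_funM => //; exact: measurable_poisson_scale.
- by move=> k x /RposE x0; rewrite lee_fin mulr_ge0// poisson_ge0// mulr_ge0// ltW.
Qed.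

Lemma eseries_pmix1 c : 0 <= c -> (\sum_(k <oo) (pmix k c)%:E = 1)%E.
Proof.
move=> c0; have := @eseries_pmix (fun=> 1) c c0 (fun=> ler01).
under eq_eseriesr do rewrite mul1r; move=> ->.
rewrite (eq_integral (cst 1%E)); first by rewrite integral_cst// mul1e; exact: Q1.
move=> x; rewrite inE => /RposE x0; under eq_eseriesr do rewrite mul1r.
by rewrite eseries_poisson// mulr_ge0// ltW.
Qed.

Lemma eseries_pmix_mean c : 0 <= c ->
  (\sum_(k <oo) (k%:R * pmix k c)%:E = (c * pmoment 1)%:E)%E.
Proof.
move=> c0; rewrite eseries_pmix// EFinM pmomentE// -ge0_integralZl//.
- apply: eq_integral => x; rewrite inE => /RposE x0.
  by rewrite eseries_poisson_mean ?expr1// mulr_ge0// ltW.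
- exact/measurable_EFinP/measurable_funX.
- by move=> x /RposE x0; rewrite lee_fin exprn_ge0// ltW.
Qed.

Lemma eseries_pmix_cube c : 0 <= c ->
  (\sum_(k <oo) (k.+1%:R ^+ 3 * pmix k c)%:E < +oo)%E.
Proof.
move=> c0; rewrite eseries_pmix//.
pose q x := 1 + 7 * (c * x * (1 + 3 * (c * x * (c * x + 1)))).
have qE x : q x = 1 * x ^+ 0 + (7 * c) * x ^+ 1 + (21 * c ^+ 2) * x ^+ 2 + (21 * c ^+ 3) * x ^+ 3.
  by rewrite /q; ring.
have intq : Q.-integrable Rpos (fun x => (q x)%:E).
  have i j (jle : (j <= 4)%N) a := integrableZl mRpos a (integrable_pmoment jle).
  have := integrableD mRpos (integrableD mRpos (integrableD mRpos
    (i 0%N isT 1) (i 1%N isT (7 * c))) (i 2%N isT (21 * c ^+ 2))) (i 3%N isT (21 * c ^+ 3)).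
  by apply: eq_integrable => // x _; rewrite qE.
apply: le_lt_trans (integrable_lty mRpos intq).
apply: ge0_le_integral => //.
- move=> x /RposE x0; apply: nneseries_ge0 => k _ _.
  by rewrite lee_fin mulr_ge0 ?exprn_ge0// poisson_ge0// mulr_ge0// ltW.
- apply: ge0_emeasurable_sum => [k x /RposE x0 _|k _].
    by rewrite lee_fin mulr_ge0 ?exprn_ge0// poisson_ge0// mulr_ge0// ltW.
  by apply/measurable_EFinP/measurable_funM => //; exact: measurable_poisson_scale.
- exact: (measurable_int _ intq).
- by move=> x /RposE x0; apply: eseries_poisson_cube_le; rewrite mulr_ge0// ltW.
Qed.

(** The factor x from the chain rule is absorbed by z p_k(z) = (k+1) p_(k+1)(z), p_k being
    [poisson k], at the price of 1/c. The derivative is then bounded uniformly in x, and a constant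
    dominates on (c/2, 2c). *)
Lemma is_derive_pmix k c : 0 < c ->
  is_derive c 1 (pmix k) ((k%:R * pmix k c - k.+1%:R * pmix k.+1 c) / c).
Proof.
move=> c0.
pose df c x := (k%:R * poisson k (c * x) - k.+1%:R * poisson k.+1 (c * x)) / c.
have c20 : 0 < c / 2 by rewrite divr_gt0.
have -> : (k%:R * pmix k c - k.+1%:R * pmix k.+1 c) / c = \int[Q]_(x in Rpos) df c x.
  have ip j : Q.-integrable Rpos (fun x => (j%:R * poisson j (c * x))%:E).
    exact: (integrableZl mRpos _ (integrable_poisson j (ltW c0))).
  rewrite /df RintegralZr//; last exact: (integrableB mRpos (ip k) (ip k.+1)).
  rewrite (RintegralB mRpos (ip k) (ip k.+1)).
  by rewrite !RintegralZl//; exact: (integrable_poisson _ (ltW c0)).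
apply: (@is_derive_under_integral R _ _ Q Rpos (fun c x => poisson k (c * x)) df
  (cst ((k%:R + k.+1%:R) / (c / 2))) c (c / 2) (2 * c)) => //.
- by apply/andP; split; lra.
- by move=> b /andP[b0 _]; apply: integrable_poisson; lra.
- move=> b x /andP[b0 _] /RposE x0; have {}b0 : 0 < b by lra.
  have dl : is_derive b 1 (fun c => c * x) x.
    by apply: is_derive_eq; rewrite /GRing.scale/=; ring.
  have := @is_derive1_comp R (poisson k) (fun c => c * x) b _ _ (is_derive_poisson k (b * x)) dl.
  rewrite (_ : _ * x = df b x)// /df -(mul_poisson k).
  case: k {df} => [|j]; first by rewrite mul0r; field; rewrite gt_eqF.
  by rewrite -(mul_poisson j); field; rewrite gt_eqF.
- move=> b x /andP[b0 _] /RposE x0; rewrite /df normrM ler_pM//.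
    rewrite (le_trans (ler_normB _ _))// !normrM !normr_nat.
    have bx0 : 0 <= b * x by rewrite mulr_ge0 ?(ltW x0)//; lra.
    by rewrite lerD// ler_piMr// ger0_norm ?poisson_ge0// poisson_le1.
  rewrite normfV gtr0_norm; last by lra.
  by rewrite lef_pV2 ?posrE//; lra.
Qed.

(** A vanishing integral of a positive function would make (0, +oo) a null set. *)
Lemma pmix0_gt0 c : 0 <= c -> 0 < pmix 0 c.
Proof.
move=> c0; rewrite lt_neqAle pmix_ge0// andbT eq_sym; apply/eqP => m0.
have p0 x : 0 < poisson 0 (c * x).
  by rewrite poissonE expr0 fact0 divr1 mulr1 expR_gt0.
have : (\int[Q]_(x in Rpos) `|(poisson 0 (c * x))%:E| = 0)%E.
  under eq_integral do rewrite gee0_abs ?lee_fin ?(ltW (p0 _))//.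
  by rewrite -pmixE// m0.
move/ae_eq_integral_abs => /(_ mRpos (measurable_int _ (integrable_poisson 0 c0))).
move=> [N [mN N0 sub]].
have : (Q Rpos <= Q N)%E.
  apply: le_measure; rewrite ?inE//; apply: subset_trans sub => x xpos /= /(_ xpos) [e].
  by have := p0 x; rewrite e ltxx.
by rewrite [X in (X <= _)%E](Q1 : Q _ = _) N0 leNgt lte01.
Qed.

Lemma pmix0_nincr b c : 0 <= b -> b <= c -> pmix 0 c <= pmix 0 b.
Proof.
move=> b0 bc; apply: le_Rintegral => //.
- by apply: integrable_poisson; exact: le_trans bc.
- exact: integrable_poisson.
- move=> x /RposE x0; rewrite !poissonE !expr0 fact0 divr1 !mulr1 ler_expR lerN2.
  by rewrite ler_pM2r.
Qed.

End PoissonMixture.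

(** * The de Bruijn identity for the entropy of the mixture in c *)

Section MixtureEntropy.
Context {R : realType}.
Variables (alpha : R) (Q : probability R R).
Local Notation mu := (@lebesgue_measure R).
Local Notation cnt := (@counting nat R).
Local Notation Rpos := (`]0%R, +oo[%classic : set R).
Local Notation gcoef := (gcoef alpha).
Local Notation gweight := (gweight alpha).
Local Notation gseries := (gseries alpha).
Local Notation M1 := (pmoment Q 1).
Hypothesis alpha_gt0 : 0 < alpha.
Hypothesis Q1 : Q Rpos = 1%E.
Hypothesis Q4 : (\int[Q]_(x in Rpos) (x ^+ 4)%:E < +oo)%E.
Implicit Types (b c y : R) (k : nat).

Let mRpos : measurable (Rpos : set (measurableTypeR R)).
Proof. exact: measurable_itv. Qed.
Let RposE y : Rpos y -> 0 < y. Proof. by rewrite /= in_itv/= andbT. Qed.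

(** Density of s X_tau relative to [gweight], as a function of c. *)
Definition pseries_mix c := gseries (fun k => pmix Q k c).
Local Notation F := pseries_mix.
(** The Euler derivative y d_y F; its shifted companion [S2] enters only through d_c F. *)
Definition mean_series c := gseries (fun k => k%:R * pmix Q k c).
Local Notation S1 := mean_series.
Let S2 c := gseries (fun k => k.+1%:R * pmix Q k.+1 c).

(** The partial sums stay below the telescoping 2 - 2/(n+1), since 1/t^2 <= 2/(t(t+1)) for t >=
    1. *)
Lemma eseries_inv_sqr_lty : (\sum_(k <oo) (k.+1%:R ^- 2 : R)%:E < +oo)%E.
Proof.
apply: (@le_lt_trans _ _ 2%:E); last exact: ltry.
apply: lime_le; first by apply: is_cvg_nneseries => k _ _; rewrite lee_fin invr_ge0 exprn_ge0.
apply: nearW => n; rewrite sumEFin lee_fin.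
suff : \sum_(0 <= k < n) (k.+1%:R ^- 2 : R) <= 2 - 2 * n.+1%:R^-1.
  by move/le_trans; apply; rewrite gerBl mulr_ge0// invr_ge0.
elim: n => [|j ih]; first by rewrite big_nil invr1; lra.
rewrite big_nat_recr//= (le_trans (lerD ih (lexx _)))//.
have t1 : 1 <= j.+1%:R :> R by rewrite ler1n.
rewrite -[j.+2%:R]natr1; move: (j.+1%:R) t1 => t t1.
have t0 : t != 0 by rewrite gt_eqF//; lra.
have t10 : t + 1 != 0 by rewrite gt_eqF//; lra.
rewrite -subr_ge0 (_ : _ - _ = (t - 1) / (t ^+ 2 * (t + 1))); last by field; apply/andP; split.
by rewrite divr_ge0 ?mulr_ge0 ?sqr_ge0//; lra.
Qed.

(** Constant of the k^-4 decay. Being nondecreasing in c, its value at 2c serves the whole interval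
    (c/2, 2c). *)
Let BB c := 625 * (1 + c ^+ 4 * pmoment Q 4).

Let BB_homo b c : 0 <= b -> b <= c -> BB b <= BB c.
Proof.
move=> b0 bc; rewrite /BB; apply: ler_wpM2l; first exact: ler0n.
by rewrite lerD2l; apply: ler_wpM2r; [exact: pmoment_ge0|rewrite lerXn2r// nnegrE (le_trans b0)].
Qed.

Let BB_ge0 c : 0 <= c -> 0 <= BB c.
Proof.
move=> c0; apply: mulr_ge0; first exact: ler0n.
by rewrite addr_ge0// mulr_ge0 ?exprn_ge0 ?pmoment_ge0.
Qed.

Let m_le k c : 0 <= c -> pmix Q k c <= BB c * k.+1%:R ^- 4.
Proof.
move=> c0; rewrite ler_pdivlMr ?exprn_gt0// mulrC.
exact: pmix_pow4_le.
Qed.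

Let m_ge0 k c : 0 <= c -> 0 <= pmix Q k c. Proof. exact: pmix_ge0. Qed.

Let m01 k c : 0 <= c -> 0 <= pmix Q k c <= 1.
Proof. by move=> c0; rewrite m_ge0// pmix_le1. Qed.

Let m_sqr_le k c : 0 <= c -> k%:R ^+ 2 * pmix Q k c <= BB c.
Proof.
move=> c0; apply: le_trans (pmix_pow4_le Q1 Q4 k c0).
rewrite ler_wpM2r ?m_ge0// (@le_trans _ _ (k.+1%:R ^+ 2))//.
  by rewrite lerXn2r ?nnegrE// ler_nat.
by rewrite ler_weXn2l// ler1n.
Qed.

Let n_le k c : 0 <= c -> k%:R * pmix Q k c <= BB c * k.+1%:R ^- 3.
Proof.
move=> c0; apply: (@le_trans _ _ (k.+1%:R * (BB c * k.+1%:R ^- 4))).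
  by apply: ler_pM => //; [exact: m_ge0|rewrite ler_nat|exact: m_le].
rewrite mulrCA ler_wpM2l ?BB_ge0// le_eqVlt; apply/orP; left; apply/eqP.
by rewrite [k.+1%:R ^+ 4]exprS invfM mulrA mulfV ?mul1r// pnatr_eq0.
Qed.

Let inv3_le1 k : k.+1%:R ^- 3 <= 1 :> R.
Proof. by rewrite invf_le1 ?exprn_gt0// exprn_ege1// ler1n. Qed.

Let n_leB k c : 0 <= c -> k%:R * pmix Q k c <= BB c.
Proof.
by move=> c0; apply: le_trans (n_le k c0) _; rewrite ler_piMr// BB_ge0.
Qed.

Let n_ge0 k c : 0 <= c -> 0 <= k%:R * pmix Q k c.
Proof. by move=> c0; rewrite mulr_ge0// m_ge0. Qed.

Let p_le k c : 0 <= c -> k.+1%:R * pmix Q k.+1 c <= BB c * k.+1%:R ^- 3.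
Proof.
move=> c0; apply: le_trans (n_le k.+1 c0) _; rewrite ler_wpM2l ?BB_ge0//.
by rewrite lef_pV2 ?posrE ?exprn_gt0// lerXn2r ?nnegrE// ler_nat.
Qed.

(** Majorant of the weights k m_k, free of c. The affine bound on the logarithm costs one more power
    of k, which leaves the summable exponent -2. *)
Let domseq C k : R := C * k.+1%:R ^- 3.

Let integrable_dom C K : 0 <= C ->
  mu.-integrable Rpos (fun y => (gweight y * gseries (domseq C) y * (K + 2 * y))%:E).
Proof.
move=> C0; have d0 k : 0 <= domseq C k by rewrite mulr_ge0// invr_ge0 exprn_ge0.
have kd k : k.+1%:R * domseq C k = C * k.+1%:R ^- 2.
  rewrite /domseq mulrCA [k.+1%:R ^+ 3]exprS invfM (mulrA k.+1%:R).
  by rewrite mulfV ?mul1r// pnatr_eq0.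
apply: (@integrable_gweight_gseries_affine _ _ alpha_gt0 _ C) => [k|k|].
- by rewrite d0/= ler_piMr.
- apply: (@le_trans _ _ (k.+1%:R * domseq C k)); first by rewrite ler_wpM2r// ler_nat.
  by rewrite kd ler_piMr// invf_le1 ?exprn_gt0// exprn_ege1// ler1n.
- under eq_eseriesr do rewrite kd EFinM.
  rewrite nneseriesZl; last by move=> k _; rewrite lee_fin invr_ge0 exprn_ge0.
  by rewrite lte_mul_pinfty// ?lee_fin// eseries_inv_sqr_lty.
Qed.

(** Combined with [is_derive_gweight_gseries], this is the equation c d_c (w F) = - d_y (y w d_y
    F). *)
Lemma is_derive_pseries_mix c y : 0 < c -> 0 < y ->
  is_derive c 1 (fun c => F c y) ((S1 c y - S2 c y) / c).
Proof.
move=> c0 y0.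
have c20 : 0 < c / 2 by rewrite divr_gt0.
have c2 : 0 <= 2 * c by rewrite mulr_ge0// ltW.
pose df b k := (k%:R * pmix Q k b - k.+1%:R * pmix Q k.+1 b) / b * (gcoef k * y ^+ k).
have nB b k : 0 <= b -> `|k%:R * pmix Q k b| <= BB b.
  by move=> b0; rewrite ger0_norm ?n_leB// n_ge0.
have pB b k : 0 <= b -> `|k.+1%:R * pmix Q k.+1 b| <= BB b by exact: nB.
have -> : (S1 c y - S2 c y) / c = \int[cnt]_k df c k.
  rewrite /S1 /S2 (gseriesB alpha_gt0 (ltW y0) (fun k => nB c k (ltW c0)) (fun k => pB c k (ltW c0))).
  rewrite mulrC (gseriesZ (C := BB c + BB c) alpha_gt0 _ (ltW y0)).
    by apply: eq_Rintegral => k _; rewrite /df (mulrC c^-1).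
  move=> k; apply: le_trans (ler_normB _ _) _.
  by apply: lerD; [apply: nB|apply: pB]; exact: ltW.
pose D := (BB (2 * c) + BB (2 * c)) / (c / 2).
apply: (@is_derive_under_integral R _ _ cnt setT
  (fun b k => pmix Q k b * (gcoef k * y ^+ k)) df
  (fun k => D * (gcoef k * y ^+ k)) c (c / 2) (2 * c)) => //.
- by apply/andP; split; lra.
- move=> b /andP[b0 _]; have {}b0 : 0 <= b by lra.
  apply: (@integrable_gseries _ _ alpha_gt0 _ 1 _ (ltW y0)) => k.
  by have /andP[? ?] := m01 k b0; rewrite ger0_norm.
- move=> b k /andP[b0 _] _; have {}b0 : 0 < b by lra.
  have dm := is_derive_pmix Q k b0.
  by apply: is_derive_eq; rewrite /GRing.scale/= /df; ring.
- exact: (@integrable_gseries _ _ alpha_gt0 (fun=> D) `|D| _ (ltW y0)).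
- move=> b k /andP[b0 b2] _; have {}b0' : 0 < b by lra.
  have g0 : 0 <= gcoef k * y ^+ k.
    by rewrite mulr_ge0 ?exprn_ge0 ?(ltW y0)// ltW// gcoef_gt0.
  rewrite /df normrM (ger0_norm g0); apply: ler_wpM2r => //.
  rewrite normrM normfV (gtr0_norm b0'); apply: ler_pM => //.
  + by rewrite invr_ge0 ltW.
  + apply: le_trans (ler_normB _ _) _.
    have hB : BB b <= BB (2 * c) by apply: BB_homo; lra.
    by apply: lerD; apply: le_trans hB; [apply: nB|apply: pB]; exact: ltW.
  + by rewrite lef_pV2 ?posrE//; lra.
Qed.

Let gseries_mono (n p : nat -> R) C y : 0 < y -> (forall k, 0 <= n k <= C) ->
  (forall k, n k <= p k <= C) -> gseries n y <= gseries p y.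
Proof.
move=> y0 nC pC.
have pC' k : 0 <= p k <= C.
  by have /andP[n0 _] := nC k; have /andP[np ->] := pC k; rewrite (le_trans n0).
rewrite -lee_fin (gseriesE alpha_gt0 (ltW y0) nC) (gseriesE alpha_gt0 (ltW y0) pC').
have g0 k : 0 <= gcoef k * y ^+ k.
  by rewrite mulr_ge0 ?exprn_ge0 ?(ltW y0)// ltW// gcoef_gt0.
apply: lee_nneseries => [k _ _|k _]; rewrite lee_fin.
  by have /andP[? _] := nC k; rewrite mulr_ge0.
by have /andP[? _] := pC k; rewrite ler_wpM2r.
Qed.

Lemma pseries_mix_gt0 c y : 0 <= c -> 0 < y -> 0 < F c y.
Proof.
move=> c0 y0.
apply: lt_le_trans (gseries_ge_head alpha_gt0 (ltW y0) (fun k => m01 k c0)).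
by rewrite mulr_gt0 ?gcoef_gt0// pmix0_gt0.
Qed.

Let Kln b := `|ln (pmix Q 0 b * gcoef 0)| + `|ln (gcoef 0 + gcoef 1)| + 1.

(** Since [pmix Q 0] is nonincreasing, the lower bound at the right end c holds for all smaller
    parameters. *)
Let norm_lnF b c y : 0 <= b -> b <= c -> 0 < y ->
  `|ln (F b y) + 1| <= Kln c + 2 * y.
Proof.
move=> b0 bc y0; apply: norm_ln_gseries_le => //.
  by move=> k; exact: m01.
have c0 := le_trans b0 bc.
by rewrite pmix0_gt0// pmix0_nincr.
Qed.

Lemma integrable_pseries_mix_affine c K : 0 <= c ->
  mu.-integrable Rpos (fun y => (gweight y * F c y * (K + 2 * y))%:E).
Proof.
move=> c0; apply: (@integrable_gweight_gseries_affine _ _ alpha_gt0 _ (1 + BB c)) => [k|k|].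
- by have /andP[-> m1]/= := m01 k c0; rewrite (le_trans m1)// lerDl BB_ge0.
- by rewrite (le_trans (n_leB k c0))// lerDr.
- apply: le_lt_trans (eseries_pmix_cube Q4 c0).
  apply: lee_nneseries => [k _ _|k _]; rewrite lee_fin.
    by rewrite mulr_ge0// m_ge0.
  by rewrite ler_wpM2r ?m_ge0// ler_eXnr// ler1n.
Qed.

Let measF c : 0 <= c -> measurable_fun Rpos (F c).
Proof.
move=> c0; apply: (@measurable_gseries _ _ alpha_gt0 _ (1 + BB c)) => k.
  by have /andP[m0 m1] := m01 k c0; rewrite ger0_norm// (le_trans m1)// lerDl BB_ge0.
by rewrite ger0_norm ?n_ge0// (le_trans (n_leB k c0))// lerDr.
Qed.

Lemma integrable_pseries_mix_ln c : 0 <= c ->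
  mu.-integrable Rpos (fun y => (gweight y * (F c y * ln (F c y)))%:E).
Proof.
move=> c0; apply: le_integrable (integrable_pseries_mix_affine (Kln c + 1) c0) => //.
  apply/measurable_EFinP/measurable_funM; first exact: measurable_gweight.
  apply: measurable_funM; first exact: measF.
  by apply: (@measurableT_comp _ _ _ _ _ _ (@ln R)); [exact: measurable_ln|exact: measF].
move=> y /RposE y0; have F0 := pseries_mix_gt0 c0 y0; have w0 := gweight_ge0 alpha y.
rewrite lee_fin mulrA normrM (ger0_norm (mulr_ge0 w0 (ltW F0))).
apply: le_trans (ler_norm _); apply: ler_wpM2l; first by rewrite mulr_ge0// ltW.
have := norm_lnF c0 (lexx c) y0.
by rewrite !ler_norml => /andP[? ?]; apply/andP; split; lra.
Qed.

(** Under the integral, d_c (F ln F) = (ln F + 1)(S1 - S2)/c, and [gseries_integration_by_parts]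
    rewrites its integral as the Fisher integral over c. *)
Lemma is_derive_mixture_entropy c : 0 < c ->
  is_derive c 1 (fun c => \int[mu]_(y in Rpos) (gweight y * (F c y * ln (F c y))))
    (c^-1 * \int[mu]_(y in Rpos) (gweight y * S1 c y ^+ 2 / (y * F c y))).
Proof.
move=> c0.
have c20 : 0 < c / 2 by rewrite divr_gt0.
have c2 : 0 <= 2 * c by rewrite mulr_ge0// ltW.
pose df b y := gweight y * ((S1 b y - S2 b y) / b * (ln (F b y) + 1)).
have [i1 i2 E] := gseries_integration_by_parts alpha_gt0
  (fun k => m01 k (ltW c0)) (pmix0_gt0 Q1 (ltW c0)) (fun k => m_sqr_le k (ltW c0))
  (eseries_pmix_cube Q4 (ltW c0)).
have -> : c^-1 * \int[mu]_(y in Rpos) (gweight y * S1 c y ^+ 2 / (y * F c y)) =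
    \int[mu]_(y in Rpos) df c y.
  transitivity (- c^-1 * \int[mu]_(y in Rpos)
      (gweight y * (S2 c y - S1 c y) * (ln (F c y) + 1))).
    by rewrite E mulrN mulNr opprK.
  by rewrite -RintegralZl//; apply: eq_Rintegral => y _; rewrite /df; ring.
(* One copy of the constant for [S1] and one for [S2], estimated separately. *)
pose C := BB (2 * c) + BB (2 * c).
apply: (@is_derive_under_integral R _ _ mu Rpos
  (fun b y => gweight y * (F b y * ln (F b y))) df
  (fun y => (c / 2)^-1 * (gweight y * gseries (domseq C) y * (Kln (2 * c) + 2 * y))) c (c / 2) (2 * c)) => //.
- by apply/andP; split; lra.
- by move=> b /andP[b0 _]; apply: integrable_pseries_mix_ln; lra.
- move=> b y /andP[b0 _] /RposE y0; have {}b0 : 0 < b by lra.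
  have dF := is_derive_pseries_mix b0 y0.
  have F0 := pseries_mix_gt0 (ltW b0) y0.
  have dl := @is_derive1_comp R (@ln R) (fun b => F b y) b _ _ (is_derive1_ln F0) dF.
  apply: is_derive_eq; rewrite /GRing.scale/= /df.
  by field; rewrite !gt_eqF.
- apply: (integrableZl mRpos _ (integrable_dom (Kln (2 * c)) _)).
  by rewrite addr_ge0// BB_ge0.
- move=> b y /andP[cb b2] /RposE y0; have b0 : 0 < b by lra.
  have nB k : 0 <= k%:R * pmix Q k b <= C.
    rewrite (n_ge0 k (ltW b0))/= (le_trans (n_leB k (ltW b0)))//.
    apply: (@le_trans _ _ (BB (2 * c))); first by apply: BB_homo; lra.
    by rewrite lerDl BB_ge0.
  have pB k : 0 <= k.+1%:R * pmix Q k.+1 b <= C := nB k.+1.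
  have norm_ub (q : nat -> R) : (forall k, 0 <= q k <= C) -> forall k, `|q k| <= C.
    by move=> qC k; have /andP[? ?] := qC k; rewrite ger0_norm.
  have S12 : S1 b y + S2 b y <= gseries (domseq C) y.
    rewrite (gseriesD alpha_gt0 (ltW y0) (norm_ub _ nB) (norm_ub _ pB)).
    apply: (@gseries_mono _ _ (C + C)) => // k.
      have /andP[? ?] := nB k; have /andP[? ?] := pB k.
      by rewrite addr_ge0//= lerD.
    have C0 : 0 <= C by have /andP[h1 h2] := nB 0%N; exact: le_trans h2.
    apply/andP; split.
      rewrite /domseq /C mulrDl.
      have Bbc : BB b * k.+1%:R ^- 3 <= BB (2 * c) * k.+1%:R ^- 3.
        rewrite ler_wpM2r ?invr_ge0 ?exprn_ge0//; apply: BB_homo; lra.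
      by apply: lerD; apply: le_trans Bbc; [exact/n_le/ltW|exact/p_le/ltW].
    by rewrite (@le_trans _ _ C)// ?lerDl// ler_piMr.
  rewrite /df normrM (ger0_norm (gweight_ge0 _ _)).
  rewrite (_ : _^-1 * _ = gweight y * ((gseries (domseq C) y * (c / 2)^-1) * (Kln (2 * c) + 2 * y))); last by ring.
  apply: ler_wpM2l; first exact: gweight_ge0.
  rewrite normrM; apply: ler_pM => //; last by apply: norm_lnF; lra.
  rewrite normrM normfV (gtr0_norm b0); apply: ler_pM => //.
  + by rewrite invr_ge0 ltW.
  + apply: le_trans (ler_normB _ _) _; rewrite !ger0_norm//.
      by apply: gseries_ge0 => // [|k]; [exact: ltW|have /andP[] := pB k].
    by apply: gseries_ge0 => // [|k]; [exact: ltW|have /andP[] := nB k].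
  + by rewrite lef_pV2 ?posrE//; lra.
Qed.


Lemma measurable_pseries_mix c : 0 <= c -> measurable_fun Rpos (F c).
Proof. exact: measF. Qed.

Lemma measurable_mean_series c : 0 <= c -> measurable_fun Rpos (S1 c).
Proof.
move=> c0; apply: (@measurable_gseries _ _ alpha_gt0 _ (BB c)) => k.
  by rewrite ger0_norm ?n_ge0// n_leB.
by rewrite mulrA -expr2 ger0_norm ?m_sqr_le// mulr_ge0 ?exprn_ge0// m_ge0.
Qed.

Lemma mean_series_bound c : 0 <= c -> exists B, forall k, 0 <= k%:R * pmix Q k c <= B.
Proof. by move=> c0; exists (BB c) => k; rewrite n_ge0// n_leB. Qed.

Lemma is_derive_y_pseries_mix c y : 0 <= c -> 0 < y ->
  is_derive y 1 (F c) (S1 c y / y).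
Proof.
move=> c0 y0; apply: (@is_derive_gseries _ _ alpha_gt0 _ (1 + BB c)) => // k.
  by have /andP[m0 m1] := m01 k c0; rewrite ger0_norm// (le_trans m1)// lerDl BB_ge0.
by rewrite ger0_norm ?n_ge0// (le_trans (n_leB k c0))// lerDr.
Qed.

Lemma integrable_mixture_fisher c : 0 < c ->
  mu.-integrable Rpos (fun y => (gweight y * S1 c y ^+ 2 / (y * F c y))%:E).
Proof.
move=> c0.
by have [] := gseries_integration_by_parts alpha_gt0
  (fun k => m01 k (ltW c0)) (pmix0_gt0 Q1 (ltW c0)) (fun k => m_sqr_le k (ltW c0))
  (eseries_pmix_cube Q4 (ltW c0)).
Qed.

End MixtureEntropy.

Lemma limn_series_EFin (R : realType) (f : nat -> R) : (forall k, 0 <= f k) ->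
  (\sum_(k <oo) (f k)%:E < +oo)%E ->
  ((limn (series f))%:E = \sum_(k <oo) (f k)%:E)%E.
Proof.
move=> f0 fin; rewrite -EFin_lim; first by congr (limn _); apply/funext => n; rewrite /= -sumEFin.
apply: nondecreasing_is_cvgn.
  by apply/nondecreasing_seqP => n; rewrite /series/= big_nat_recr//= lerDl.
exists (fine (\sum_(k <oo) (f k)%:E)) => _ [n _ <-].
rewrite -lee_fin fineK; last first.
  by rewrite ge0_fin_numE// nneseries_ge0// => k _ _; rewrite lee_fin.
rewrite /series/= -sumEFin; apply: nneseries_lim_ge => k _.
by rewrite lee_fin.
Qed.

(** * The density of the smart path as a gamma mixture *)

Section SmartPath.
Context {R : realType}.
Variables (alpha lam : R) (Q : probability R R).
Local Notation mu := (@lebesgue_measure R).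
Local Notation Rpos := (`]0%R, +oo[%classic : set R).
Local Notation gcoef := (gcoef alpha).
Local Notation gweight := (gweight alpha).
Local Notation F := (pseries_mix alpha Q).
Local Notation S1 := (mean_series alpha Q).
Local Notation M1 := (pmoment Q 1).
Hypothesis alpha_gt0 : 0 < alpha.
Hypothesis lam_gt0 : 0 < lam.
Hypothesis Q1 : Q Rpos = 1%E.
Hypothesis Q4 : (\int[Q]_(x in Rpos) (x ^+ 4)%:E < +oo)%E.
Implicit Types (c s tau u x y : R) (k : nat).

Let RposE y : Rpos y -> 0 < y. Proof. by rewrite /= in_itv/= andbT. Qed.

Let gterm_ge0 k y : 0 <= y -> 0 <= gcoef k * y ^+ k.
Proof. by move=> y0; rewrite mulr_ge0 ?exprn_ge0// ltW// gcoef_gt0. Qed.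

Let kernel_lty c x y : 0 <= c -> 0 < x -> 0 <= y ->
  (\sum_(k <oo) (gcoef k * y ^+ k * poisson k (c * x))%:E < +oo)%E.
Proof.
move=> c0 x0 y0; apply: le_lt_trans (_ : (_ <= (gcoef 0 + gcoef 1 * y * expR y)%:E)%E) _.
  apply: le_trans (eseries_gcoef_le alpha_gt0 y0).
  have cx0 : 0 <= c * x by rewrite mulr_ge0// ltW.
  apply: lee_nneseries => [k _ _|k _]; rewrite lee_fin.
    by rewrite mulr_ge0 ?gterm_ge0// poisson_ge0.
  by rewrite ler_piMr ?gterm_ge0// poisson_le1.
exact: ltry.
Qed.

Let gterm_poisson_ge0 k c x y : 0 <= c -> 0 < x -> 0 <= y ->
  0 <= gcoef k * y ^+ k * poisson k (c * x).
Proof.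
by move=> c0 x0 y0; apply: mulr_ge0; [exact: gterm_ge0|rewrite poisson_ge0// mulr_ge0// ltW].
Qed.

(** With q = sqrt(u x tau), (s q)^(2k) = (s u)^k (s tau x)^k. The second factor, the exponential and
    k! form a Poisson weight, while the remaining power (s q)^(alpha-1) cancels the power of x. *)
Lemma besselI_kernelE s tau u x : 0 < s -> 0 < tau -> 0 < u -> 0 < x ->
  ((x `^ (- ((alpha - 1) / 2)) * expR (- (s * tau * x)) *
     besselI (alpha - 1) (2 * s * Num.sqrt (u * x * tau)))%:E =
   ((s ^+ 2 * u * tau) `^ ((alpha - 1) / 2))%:E *
   \sum_(k <oo) (gcoef k * (s * u) ^+ k * poisson k (s * tau * x))%:E)%E.
Proof.
move=> s0 tau0 u0 x0; rewrite /besselI.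
set a := (alpha - 1) / 2; set q := Num.sqrt (u * x * tau).
have q0 : 0 < q by rewrite sqrtr_gt0 !mulr_gt0.
have q2 : q ^+ 2 = u * x * tau by rewrite sqr_sqrtr// !mulr_ge0// ltW.
have sq0 : 0 < s * q by rewrite mulr_gt0.
have su0 : 0 <= s * u by rewrite mulr_ge0// ltW.
have stau0 : 0 <= s * tau by rewrite mulr_ge0// ltW.
have K0 : 0 < (s ^+ 2 * u * tau) `^ a by rewrite powR_gt0// !mulr_gt0// exprn_gt0.
have xa0 : 0 < x `^ (- a) by rewrite powR_gt0.
set r := (s ^+ 2 * u * tau) `^ a / (x `^ (- a) * expR (- (s * tau * x))).
have termE k : (2 * s * q / 2) `^ (2 * k%:R + (alpha - 1)) /
    (k`!%:R * Gamma (k%:R + (alpha - 1) + 1)) =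
    r * (gcoef k * (s * u) ^+ k * poisson k (s * tau * x)).
  rewrite (_ : 2 * s * q / 2 = s * q); last by field.
  rewrite powRD ?(gt_eqF sq0) ?implybT// gcoefE poissonE /r.
  rewrite (_ : k%:R + (alpha - 1) + 1 = k%:R + alpha); last by ring.
  rewrite powRrM powR_mulrn; last by rewrite powR_ge0.
  rewrite (_ : (s * q) `^ 2 = s ^+ 2 * (u * x * tau)); last first.
    by rewrite (powR_mulrn 2) ?(ltW sq0)// exprMn q2.
  have -> : (s * q) `^ (alpha - 1) = (s ^+ 2 * u * tau) `^ a * x `^ a.
    rewrite (_ : alpha - 1 = 2 * a); last by rewrite /a; field.
    rewrite powRrM (powR_mulrn 2) ?(ltW sq0)// exprMn q2.
    rewrite (_ : s ^+ 2 * (u * x * tau) = s ^+ 2 * u * tau * x); last by ring.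
    by rewrite powRM ?(ltW x0)// !mulr_ge0 ?sqr_ge0// ltW.
  rewrite powRN.
  have xa : x `^ a != 0 by rewrite gt_eqF// powR_gt0.
  have e0 : expR (- (s * tau * x)) != 0 by rewrite gt_eqF// expR_gt0.
  have G0 : Gamma (k%:R + alpha) != 0.
    by rewrite gt_eqF// Gamma_gt0// ltr_wpDl.
  have f0 : k`!%:R != 0 :> R by rewrite pnatr_eq0 gtn_eqF// fact_gt0.
  rewrite (_ : s ^+ 2 * (u * x * tau) = (s * u) * (s * tau * x)); last by ring.
  rewrite exprMn; move: ((s * u) ^+ k) ((s * tau * x) ^+ k) => A B.
  by field; rewrite xa e0 G0 f0.
rewrite (funext termE) EFinM limn_series_EFin; last 2 first.
- by move=> k; rewrite mulr_ge0 ?gterm_poisson_ge0// /r divr_ge0 ?mulr_ge0 ?expR_ge0 ?ltW.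
- under eq_eseriesr do rewrite EFinM.
  rewrite nneseriesZl; last by move=> k _; rewrite lee_fin gterm_poisson_ge0.
  rewrite lte_mul_pinfty ?lee_fin// ?kernel_lty//.
  by rewrite /r divr_ge0 ?mulr_ge0 ?expR_ge0 ?powR_ge0.
under eq_eseriesr do rewrite EFinM.
rewrite nneseriesZl; last by move=> k _; rewrite lee_fin gterm_poisson_ge0.
rewrite muleA -EFinM; congr (_%:E * _)%E.
by rewrite /r mulrC divfK// mulf_neq0 ?gt_eqF ?expR_gt0.
Qed.

Let kernel tau s u x : R := x `^ (- ((alpha - 1) / 2)) * expR (- (s * tau * x)) *
  besselI (alpha - 1) (2 * s * Num.sqrt (u * x * tau)).

Let measurable_kernel tau s u : 0 < s -> 0 < tau -> 0 < u ->
  measurable_fun setT (kernel tau s u).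
Proof.
move=> s0 tau0 u0.
have mRp : measurable Rpos by exact: measurable_itv.
rewrite -(setUv Rpos); apply/measurable_funU => //; first exact: measurableC.
have mexp (D : set R) : measurable_fun D (fun x => x `^ (- ((alpha - 1) / 2)) * expR (- (s * tau * x))).
  apply: measurable_funTS; apply: measurable_funM; first exact: measurable_powR.
  apply: (@measurableT_comp _ _ _ _ _ _ (@expR R)); first exact: measurable_expR.
  by apply: measurable_funN; exact: measurable_funM.
split.
  apply: (eq_measurable_fun (fun x => fine (((s ^+ 2 * u * tau) `^ ((alpha - 1) / 2))%:E *
     \sum_(k <oo) (gcoef k * (s * u) ^+ k * poisson k (s * tau * x))%:E)%E)).
    by move=> x; rewrite inE => /RposE x0; rewrite -besselI_kernelE.
  apply: (@measurableT_comp _ _ _ _ _ _ (@fine R)); first exact: fine_measurable.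
  apply: emeasurable_funM; first exact: measurable_cst.
  have su0 : 0 <= s * u by rewrite mulr_ge0// ltW.
  have stau0 : 0 <= s * tau by rewrite mulr_ge0// ltW.
  apply: ge0_emeasurable_sum => [k x /RposE x0 _|k _].
    by rewrite lee_fin gterm_poisson_ge0.
  apply/measurable_EFinP; apply: measurable_funM; first exact: measurable_cst.
  exact: measurable_poisson_scale.
(* For x <= 0 the square root takes its default value 0, so the Bessel factor is constant there. *)
apply: (eq_measurable_fun (fun x => x `^ (- ((alpha - 1) / 2)) * expR (- (s * tau * x)) *
    besselI (alpha - 1) 0)).
  move=> x; rewrite inE /= in_itv/= andbT => /negP; rewrite -leNgt => x0.
  rewrite /kernel ler0_sqrtr ?mulr0// mulrAC pmulr_rle0 ?mulr_gt0//.
by apply: measurable_funM => //; exact: mexp.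
Qed.

Lemma smart_path_densityE tau u : 0 < tau < 1 -> 0 < u ->
  smart_path_density alpha lam Q tau u =
  lam / (1 - tau) * (gweight (lam / (1 - tau) * u) *
    F (lam * tau / (1 - tau)) (lam / (1 - tau) * u)).
Proof.
move=> /andP[tau0 tau1] u0; rewrite /smart_path_density.
have t1 : 0 < 1 - tau by lra.
set s := lam / (1 - tau); have s0 : 0 < s by rewrite divr_gt0.
have -> : lam * tau / (1 - tau) = s * tau by rewrite /s mulrAC.
have kerE x : x `^ (- ((alpha - 1) / 2)) * expR (- (lam * tau * x / (1 - tau))) *
    besselI (alpha - 1) (2 * lam * Num.sqrt (u * x * tau) / (1 - tau)) = kernel tau s u x.
  rewrite /kernel (_ : s * tau * x = lam * tau * x / (1 - tau)); last by rewrite /s; ring.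
  by congr (_ * besselI _ _); rewrite /s; ring.
under eq_integral do rewrite kerE.
have mRp : measurable Rpos by exact: measurable_itv.
have su0 : 0 <= s * u by rewrite mulr_ge0// ltW.
have stau0 : 0 <= s * tau by rewrite mulr_ge0// ltW.
(* The density integrates over the whole line, while the series expansion holds only for x > 0; the
   law of X does not charge the rest. *)
have QC : Q (~` Rpos) = 0%E.
  by rewrite probability_setC// [X in (1 - X)%E](Q1 : Q _ = _) subee.
have -> : (\int[Q]_x (kernel tau s u x)%:E = \int[Q]_(x in Rpos) (kernel tau s u x)%:E)%E.
  rewrite [RHS]integral_mkcond; apply: ae_eq_integral => //.
  - by apply/measurable_EFinP; exact: measurable_kernel.
  - apply/measurable_restrict => //; apply: measurable_funTS.
    by apply/measurable_EFinP; exact: measurable_kernel.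
  - exists (~` Rpos); split => //; first exact: measurableC.
    by move=> x /= h xpos; apply: h => _; rewrite patchE mem_set.
have -> : (\int[Q]_(x in Rpos) (kernel tau s u x)%:E =
    ((s ^+ 2 * u * tau) `^ ((alpha - 1) / 2) * F (s * tau) (s * u))%:E)%E.
  rewrite EFinM (gseriesE (C := 1) alpha_gt0 su0); last first.
    by move=> k; rewrite pmix_ge0// pmix_le1.
  transitivity (((s ^+ 2 * u * tau) `^ ((alpha - 1) / 2))%:E *
    \int[Q]_(x in Rpos) \sum_(k <oo) (gcoef k * (s * u) ^+ k * poisson k (s * tau * x))%:E)%E.
    rewrite -ge0_integralZl//.
    - by apply: eq_integral => x; rewrite inE => /RposE x0; rewrite -besselI_kernelE.
    - apply: ge0_emeasurable_sum => [k x /RposE x0 _|k _].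
        by rewrite lee_fin gterm_poisson_ge0.
      apply/measurable_EFinP; apply: measurable_funM; first exact: measurable_cst.
      exact: measurable_poisson_scale.
    - move=> x /RposE x0; apply: nneseries_ge0 => k _ _.
      by rewrite lee_fin gterm_poisson_ge0.
    - by rewrite lee_fin powR_ge0.
  congr (_ * _)%E; rewrite -eseries_pmix//.
    by apply: eq_eseriesr => k _; rewrite mulrC.
  by move=> k; exact: gterm_ge0.
rewrite [fine _]/= gweightE.
have -> : (s * u) `^ (alpha - 1) = (u / tau) `^ ((alpha - 1) / 2) *
    (s ^+ 2 * u * tau) `^ ((alpha - 1) / 2).
  have e1 : 0 <= u / tau by apply/ltW/divr_gt0.
  have e2 : 0 <= s ^+ 2 * u * tau by rewrite ltW// mulr_gt0// mulr_gt0// exprn_gt0.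
  rewrite -(powRM _ e1 e2).
  rewrite (_ : u / tau * (s ^+ 2 * u * tau) = (s * u) ^+ 2); last by field; rewrite gt_eqF.
  rewrite -(powR_mulrn 2) ?su0// -powRrM; congr (_ `^ _).
  by field.
rewrite (_ : lam * u / (1 - tau) = s * u); last by rewrite /s; ring.
by ring.
Qed.

End SmartPath.

(** * Divergence and Fisher information along the path *)

Lemma ge0_integrable_Rintegral (R : realType) d (T : measurableType d)
    (mu : {measure set T -> \bar R}) (D : set T) (f : T -> R) (r : R) :
  measurable D -> measurable_fun D f -> (forall x, D x -> 0 <= f x) ->
  (\int[mu]_(x in D) (f x)%:E = r%:E)%E ->
  mu.-integrable D (EFin \o f) /\ \int[mu]_(x in D) f x = r.
Proof.
move=> mD mf f0 fr; split; last by rewrite /Rintegral fr.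
apply/integrableP; split; first exact/measurable_EFinP.
rewrite (eq_integral (fun x => (f x)%:E)) ?fr ?ltry// => x.
by rewrite inE => Dx; rewrite /= ger0_norm ?f0.
Qed.

Section SmartPathEntropy.
Context {R : realType}.
Variables (alpha lam : R) (Q : probability R R).
Local Notation mu := (@lebesgue_measure R).
Local Notation Rpos := (`]0%R, +oo[%classic : set R).
Local Notation gcoef := (gcoef alpha).
Local Notation gweight := (gweight alpha).
Local Notation F := (pseries_mix alpha Q).
Local Notation S1 := (mean_series alpha Q).
Local Notation M1 := (pmoment Q 1).
Hypothesis alpha_gt0 : 0 < alpha.
Hypothesis lam_gt0 : 0 < lam.
Hypothesis Q1 : Q Rpos = 1%E.
Hypothesis Q4 : (\int[Q]_(x in Rpos) (x ^+ 4)%:E < +oo)%E.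
Implicit Types (c s tau u x y : R) (k : nat).

Let mRpos : measurable (Rpos : set (measurableTypeR R)).
Proof. exact: measurable_itv. Qed.
Let RposE y : Rpos y -> 0 < y. Proof. by rewrite /= in_itv/= andbT. Qed.

Let E c := \int[mu]_(y in Rpos) (gweight y * (F c y * ln (F c y))).
Let I c := \int[mu]_(y in Rpos) (gweight y * S1 c y ^+ 2 / (y * F c y)).

Let F_gt0 c y : 0 <= c -> 0 < y -> 0 < F c y.
Proof. by move=> c0 y0; exact: pseries_mix_gt0. Qed.

Let S1_ge0 c y : 0 <= c -> 0 < y -> 0 <= S1 c y.
Proof.
move=> c0 y0; apply: gseries_ge0 => // [|k]; first exact: ltW.
by rewrite mulr_ge0// pmix_ge0.
Qed.

Let wF_facts c : 0 <= c ->
  mu.-integrable Rpos (fun y => (gweight y * F c y)%:E) /\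
  \int[mu]_(y in Rpos) (gweight y * F c y) = 1.
Proof.
move=> c0; apply: ge0_integrable_Rintegral => //.
- by apply: measurable_funM; [exact: measurable_gweight|exact: (measurable_pseries_mix alpha_gt0 Q1 Q4)].
- by move=> y /RposE y0; rewrite mulr_ge0 ?gweight_ge0// ltW// F_gt0.
- rewrite (integral_gweight_gseries (C := 1) alpha_gt0); last first.
    by move=> k; rewrite pmix_ge0// pmix_le1.
  exact: eseries_pmix1.
Qed.

Let ywF_facts c : 0 <= c ->
  mu.-integrable Rpos (fun y => (y * (gweight y * F c y))%:E) /\
  \int[mu]_(y in Rpos) (y * (gweight y * F c y)) = alpha + c * M1.
Proof.
move=> c0; apply: ge0_integrable_Rintegral => //.
- apply: measurable_funM => //.
  by apply: measurable_funM; [exact: measurable_gweight|exact: (measurable_pseries_mix alpha_gt0 Q1 Q4)].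
- by move=> y /RposE y0; rewrite !mulr_ge0 ?gweight_ge0 ?(ltW y0)// ltW// F_gt0.
- rewrite (integral_gweight_gseriesX (C := 1) alpha_gt0); last first.
    by move=> k; rewrite pmix_ge0// pmix_le1.
  rewrite EFinD -(eseries_pmix_mean Q4 c0) -[X in (X%:E + _)%E]mulr1 EFinM -(eseries_pmix1 Q1 c0).
  rewrite -nneseriesZl; last by move=> k _; rewrite lee_fin pmix_ge0.
  rewrite -nneseriesD; last 2 first.
  - by move=> k _ _; rewrite -EFinM lee_fin mulr_ge0 ?pmix_ge0// ltW.
  - by move=> k _ _; rewrite lee_fin mulr_ge0 ?pmix_ge0.
  by apply: eq_eseriesr => k _; rewrite -EFinM -EFinD; congr EFin; ring.
Qed.

(** The integral is the mean of the mixing index K. *)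
Let wS1_facts c : 0 <= c ->
  mu.-integrable Rpos (fun y => (gweight y * S1 c y)%:E) /\
  \int[mu]_(y in Rpos) (gweight y * S1 c y) = c * M1.
Proof.
move=> c0; apply: ge0_integrable_Rintegral => //.
- by apply: measurable_funM; [exact: measurable_gweight|exact: (measurable_mean_series alpha_gt0 Q1 Q4)].
- by move=> y /RposE y0; rewrite mulr_ge0 ?gweight_ge0// S1_ge0.
- have [B nB] := mean_series_bound Q1 Q4 c0.
  by rewrite (integral_gweight_gseries (C := B) alpha_gt0)// eseries_pmix_mean.
Qed.

Let I_integrable c : 0 < c ->
  mu.-integrable Rpos (fun y => (gweight y * S1 c y ^+ 2 / (y * F c y))%:E).
Proof. exact: (integrable_mixture_fisher alpha_gt0 Q1 Q4). Qed.

Let wFlnF_integrable c : 0 <= c ->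
  mu.-integrable Rpos (fun y => (gweight y * (F c y * ln (F c y)))%:E).
Proof. exact: integrable_pseries_mix_ln. Qed.

(** From s u = lam u + tau s u, the quotient of exponentials leaves e^(-tau s u); the powers of lam
    and s leave (1 - tau)^(-alpha). *)
Let log_ratio tau u : 0 < tau < 1 -> 0 < u ->
  let s := lam / (1 - tau) in let c := lam * tau / (1 - tau) in
  ln (smart_path_density alpha lam Q tau u / gamma_pdf alpha lam u) =
  ln (Gamma alpha) - alpha * ln (1 - tau) - tau * (s * u) + ln (F c (s * u)).
Proof.
move=> /[dup] t01 /andP[t0 t1] u0 s c.
have t10 : 0 < 1 - tau by lra.
have s0 : 0 < s by rewrite divr_gt0.
have c0 : 0 <= c by rewrite /c divr_ge0 ?mulr_ge0 ?ltW.
have F0 : 0 < F c (s * u) by apply: F_gt0 => //; exact: mulr_gt0.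
have G0 := Gamma_gt0 alpha_gt0.
rewrite smart_path_densityE// -/s -/c gweightE.
have -> : s * ((s * u) `^ (alpha - 1) * expR (- (s * u)) * F c (s * u)) /
    gamma_pdf alpha lam u =
    Gamma alpha * ((1 - tau) `^ (- alpha) * (expR (- (tau * (s * u))) * F c (s * u))).
  have -> : - (s * u) = - (lam * u) + - (tau * (s * u)).
    by rewrite /s; field; rewrite gt_eqF.
  rewrite /gamma_pdf expRD powRM ?(ltW s0) ?(ltW u0)// powRN.
  have -> : lam `^ alpha = s `^ (alpha - 1) * s * (1 - tau) `^ alpha.
    rewrite (mulrC _ s) mulr_powRB1 ?(ltW s0)// -powRM ?(ltW s0) ?(ltW t10)//.
    by rewrite /s divfK// gt_eqF.
  have p1 := powR_gt0 (alpha - 1) s0; have p2 := powR_gt0 (alpha - 1) u0.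
  have p3 := powR_gt0 alpha t10.
  by field; rewrite !gt_eqF ?expR_gt0.
have e0 := expR_gt0 (- (tau * (s * u))).
have p0 := powR_gt0 (- alpha) t10.
rewrite lnM ?posrE ?mulr_gt0// lnM ?posrE ?mulr_gt0// lnM ?posrE ?mulr_gt0//.
by rewrite expRK ln_powR; ring.
Qed.

(** Substituting y = s u and inserting mass 1 and mean alpha + c M1 leaves the entropy as the only
    term that is not explicit. *)
Lemma KL_gamma_smart_path tau : 0 < tau < 1 ->
  let c := lam * tau / (1 - tau) in
  (KL_gamma alpha lam (smart_path_density alpha lam Q tau) =
   (ln (Gamma alpha) - alpha * ln (1 - tau) - tau * (alpha + c * M1) +
    \int[mu]_(y in Rpos) (gweight y * (F c y * ln (F c y))))%:E)%E.
Proof.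
move=> /[dup] t01 /andP[t0 t1] c.
have t10 : 0 < 1 - tau by lra.
pose s := lam / (1 - tau); have s0 : 0 < s by rewrite divr_gt0.
have c0 : 0 <= c by rewrite /c divr_ge0 ?mulr_ge0 ?ltW.
pose k0 := ln (Gamma alpha) - alpha * ln (1 - tau).
have [i1 e1] := wF_facts c0; have [i2 e2] := ywF_facts c0; have i3 := wFlnF_integrable c0.
pose phi y := k0 * (gweight y * F c y) - tau * (y * (gweight y * F c y)) +
  gweight y * (F c y * ln (F c y)).
have i12 := integrableB mRpos (integrableZl mRpos k0 i1) (integrableZl mRpos tau i2).
have iphi : mu.-integrable Rpos (EFin \o phi) by exact: (integrableD mRpos i12 i3).
transitivity (\int[mu]_(u in Rpos) (s * phi (s * u))%:E)%E.
  apply: eq_integral => u; rewrite inE => /RposE u0.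
  rewrite log_ratio// smart_path_densityE// -/s -/c /phi /k0; congr EFin; ring.
have /measurable_int/measurable_EFinP mphi := iphi.
rewrite (integral_scale s0 mphi).
rewrite -[LHS]fineK ?(integrable_fin_num mRpos iphi)//; congr EFin.
rewrite -[LHS]/(\int[mu]_(y in Rpos) phi y) /phi RintegralD//.
rewrite RintegralB//; [|exact: (integrableZl mRpos k0 i1)|exact: (integrableZl mRpos tau i2)].
by rewrite !RintegralZl// e1 e2 mulr1.
Qed.

(** The term (alpha - 1)/u cancels against the logarithmic derivative of the weight, and lam - s = -
    s tau. *)
Let score tau u : 0 < tau < 1 -> 0 < u ->
  let s := lam / (1 - tau) in let c := lam * tau / (1 - tau) in
  derive1 (fun v => ln (smart_path_density alpha lam Q tau v)) u - (alpha - 1) / u + lam =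
  s * (S1 c (s * u) / (s * u * F c (s * u)) - tau).
Proof.
move=> /[dup] t01 /andP[t0 t1] u0 s c.
have t10 : 0 < 1 - tau by lra.
have s0 : 0 < s by rewrite divr_gt0.
have c0 : 0 <= c by rewrite /c divr_ge0 ?mulr_ge0 ?ltW.
have y0 : 0 < s * u by rewrite mulr_gt0.
have F0 := F_gt0 c0 y0; have w0 := gweight_gt0 alpha y0.
have dl : is_derive u 1 (fun v => s * v) s.
  by apply: is_derive_eq; rewrite /GRing.scale/=; ring.
have dF := is_derive1_comp (is_derive_y_pseries_mix alpha_gt0 Q1 Q4 c0 y0) dl.
have dw := is_derive1_comp (is_derive_gweight alpha y0) dl.
have F0' : 0 < s * (gweight (s * u) * F c (s * u)).
  by apply: mulr_gt0 => //; exact: mulr_gt0.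
have dg : is_derive u 1 (fun v => s * (gweight (s * v) * F c (s * v)))
    (s * (gweight (s * u) * F c (s * u)) * ((alpha - 1) / u - s + s * (S1 c (s * u) / (s * u * F c (s * u))))).
  apply: is_derive_eq; rewrite /GRing.scale/=.
  by field; rewrite !gt_eqF.
have := @is_derive1_comp R (@ln R) _ u _ _ (is_derive1_ln F0') dg.
rewrite mulKf ?gt_eqF// => dlng.
rewrite derive1E.
(* The mixture formula holds for v > 0, which is a neighbourhood of u. *)
rewrite (@near_eq_derive _ _ _ _
    (@ln R \o (fun v => s * (gweight (s * v) * F c (s * v)))))//; last first.
  near=> v; have v0 : 0 < v by near: v; exact: lt_nbhsr.
  by rewrite /= smart_path_densityE.
have [_ ->] := dlng; rewrite /s; field.
by rewrite !gt_eqF.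
Unshelve. end_near. Qed.

(** Expand the square after y = s u: the cross term is the mean c M1 of the mixing index, the last
    one the mean alpha + c M1 of s X_tau. *)
Lemma Jst_gamma_smart_path tau : 0 < tau < 1 ->
  let s := lam / (1 - tau) in let c := lam * tau / (1 - tau) in
  (Jst_gamma alpha lam (smart_path_density alpha lam Q tau) =
   (s * (\int[mu]_(y in Rpos) (gweight y * S1 c y ^+ 2 / (y * F c y)) -
         2 * tau * (c * M1) + tau ^+ 2 * (alpha + c * M1)))%:E)%E.
Proof.
move=> /[dup] t01 /andP[t0 t1] s c.
have t10 : 0 < 1 - tau by lra.
have s0 : 0 < s by rewrite divr_gt0.
have c0 : 0 < c by rewrite /c divr_gt0// mulr_gt0.
have [i1 e1] := wS1_facts (ltW c0); have [i2 e2] := ywF_facts (ltW c0).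
have i3 := I_integrable c0.
pose phi y := s * (gweight y * S1 c y ^+ 2 / (y * F c y) -
  2 * tau * (gweight y * S1 c y) + tau ^+ 2 * (y * (gweight y * F c y))).
have i4 := integrableB mRpos i3 (integrableZl mRpos (2 * tau) i1).
have i5 := integrableD mRpos i4 (integrableZl mRpos (tau ^+ 2) i2).
have iphi : mu.-integrable Rpos (EFin \o phi) by exact: (integrableZl mRpos s i5).
transitivity (\int[mu]_(u in Rpos) (s * phi (s * u))%:E)%E.
  apply: eq_integral => u; rewrite inE => /RposE u0.
  have F0 : 0 < F c (s * u) by apply: F_gt0; [exact: ltW|exact: mulr_gt0].
  rewrite score// smart_path_densityE// -/s -/c /phi; congr EFin; field.
  by rewrite !gt_eqF.
have /measurable_int/measurable_EFinP mphi := iphi.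
rewrite (integral_scale s0 mphi).
rewrite -[LHS]fineK ?(integrable_fin_num mRpos iphi)//; congr EFin.
rewrite -[LHS]/(\int[mu]_(y in Rpos) phi y) /phi RintegralZl//.
rewrite RintegralD//; last exact: (integrableZl mRpos (tau ^+ 2) i2).
rewrite RintegralB//; last exact: (integrableZl mRpos (2 * tau) i1).
by rewrite !RintegralZl// e1 e2.
Qed.

(** In the chain rule c'/c = 1/(tau (1 - tau)) = s/(lam tau), so the Fisher integrals agree; the
    alpha and M1 terms match algebraically. *)
Lemma derive_KL_smart_path tau : 0 < tau < 1 ->
  is_derive tau 1 (fun t => fine (KL_gamma alpha lam (smart_path_density alpha lam Q t)))
    ((lam * tau)^-1 * fine (Jst_gamma alpha lam (smart_path_density alpha lam Q tau))).
Proof.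
move=> /[dup] t01 /andP[t0 t1].
have t10 : 0 < 1 - tau by lra.
pose c t := lam * t / (1 - t).
have c0 : 0 < c tau by rewrite /c divr_gt0// mulr_gt0.
have dc : is_derive tau 1 c (lam / (1 - tau) ^+ 2).
  have d1 : is_derive tau 1 (fun t : R => 1 - t) (- 1).
    by apply: is_derive_eq; ring.
  have n1 : 1 - tau != 0 by rewrite gt_eqF.
  have dV := @is_deriveV R (fun t => 1 - t) tau _ 1 n1 d1.
  apply: is_derive_eq; rewrite /GRing.scale/=.
  by field; rewrite gt_eqF.
have dln : is_derive tau 1 (fun t : R => ln (1 - t)) (- (1 - tau)^-1).
  have d1 : is_derive tau 1 (fun t : R => 1 - t) (- 1).
    by apply: is_derive_eq; ring.
  have := @is_derive1_comp R (@ln R) (fun t => 1 - t) tau _ _ (is_derive1_ln t10) d1.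
  by rewrite mulrN1.
have dE := @is_derive1_comp R E c tau _ _ (is_derive_mixture_entropy alpha_gt0 Q1 Q4 c0) dc.
pose D t := ln (Gamma alpha) - alpha * ln (1 - t) - t * (alpha + c t * M1) + E (c t).
have dD : is_derive tau 1 D
    ((lam * tau)^-1 * fine (Jst_gamma alpha lam (smart_path_density alpha lam Q tau))).
  rewrite Jst_gamma_smart_path//= -/(c tau) -/(I (c tau)).
  apply: is_derive_eq; rewrite /GRing.scale/= /c -/(I _).
  by field; rewrite !gt_eqF.
have nD : {near tau, D =1 (fun t => fine (KL_gamma alpha lam (smart_path_density alpha lam Q t)))}.
  near=> t.
  have tt : 0 < t < 1.
    have : t \in `]0, 1[ by near: t; apply: near_in_itvoo; rewrite in_itv/= t0.
    by rewrite in_itv.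
  by rewrite KL_gamma_smart_path.
split.
  by apply: (@near_eq_derivable _ _ _ D); [exact: nD|have [] := dD].
by rewrite -(@near_eq_derive _ _ _ D)//; have [_ ->] := dD.
Unshelve. all: end_near. Qed.

End SmartPathEntropy.

(** * From the random variable X to its law on (0, +oo) *)

Unset Implicit Arguments.

Theorem theorem4p1 (R : realType) (d : measure_display) (T : measurableType d)
  (P : probability T R) (X : {RV P >-> R}) (alpha lam : R) :
  1 / 2 <= alpha -> 0 < lam ->
  {ae P, forall w, 0 < X w} ->
  ('E_P[fun w => (X w `^ (alpha + 4))%R] < +oo)%E ->
  let g := smart_path_density alpha lam (distribution P X) in
  let Dfun := fun tau => fine (KL_gamma alpha lam (g tau)) in
  forall tau, 0 < tau < 1 ->
    KL_gamma alpha lam (g tau) \is a fin_num /\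
    derivable Dfun tau 1 /\
    ((derive1 Dfun tau)%:E = ((lam * tau)^-1)%:E * Jst_gamma alpha lam (g tau))%E.
Proof.
move=> alpha12 lam0 Xpos EX g Dfun tau t01.
have alpha0 : 0 < alpha by lra.
pose Q : probability R R := distribution P X.
have mRpos : measurable (`]0%R, +oo[%classic : set R) by exact: measurable_itv.
have Q1 : Q (`]0%R, +oo[%classic : set R) = 1%E.
  have QC : Q (~` (`]0%R, +oo[%classic : set R)) = 0%E.
    have [N [mN N0 sub]] := Xpos.
    have mC : measurable (X @^-1` (~` (`]0%R, +oo[%classic : set R))).
      by rewrite -[X in measurable X]setTI; apply: measurable_funPT => //; exact: measurableC.
    have -> : Q (~` (`]0%R, +oo[%classic : set R)) =
        P (X @^-1` (~` (`]0%R, +oo[%classic : set R))) by [].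
    apply/eqP; rewrite eq_le measure_ge0 andbT -[X in (_ <= X)%E]N0.
    apply: le_measure; rewrite ?inE//.
    apply: subset_trans sub => w /=; rewrite in_itv/= andbT => nX pos.
    by apply: nX.
  by rewrite -[X in Q X]setCK probability_setC ?QC ?sube0//; exact: measurableC.
have Q4 : (\int[Q]_(x in (`]0%R, +oo[%classic : set R)) (x ^+ 4)%:E < +oo)%E.
  have mpow : measurable_fun setT (fun x : R => x `^ (alpha + 4)) by exact: measurable_powR.
  (* For x > 0, x^4 is at most 1 if x <= 1 and at most x^(alpha+4) otherwise. *)
  apply: (@le_lt_trans _ _ (\int[Q]_x (1 + (x `^ (alpha + 4))%:E)%E)%E).
    apply: (@le_trans _ _ (\int[Q]_(x in (`]0%R, +oo[%classic : set R)) (1 + (x `^ (alpha + 4))%:E)%E)%E).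
      apply: ge0_le_integral => //.
      - by move=> x _; rewrite lee_fin exprn_even_ge0.
      - exact/measurable_EFinP/measurable_funX.
      - by apply/measurable_EFinP/measurable_funD => //; exact: measurable_funTS.
      - move=> x /=; rewrite in_itv/= andbT => x0; rewrite -EFinD lee_fin.
        case: (lerP x 1) => x1.
          rewrite (@le_trans _ _ 1)// ?exprn_ile1 ?(ltW x0)//.
          by rewrite lerDl powR_ge0.
        rewrite (@le_trans _ _ (x `^ (alpha + 4)))// ?lerDr//.
        by rewrite -(powR_mulrn 4) ?(ltW x0)// ler_powR ?(ltW x1)// lerDr ltW.
    apply: ge0_subset_integral => //.
      by apply/measurable_EFinP/measurable_funD.
    by move=> x _; rewrite -EFinD lee_fin addr_ge0// powR_ge0.
  rewrite ge0_integralD//; last 2 first.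
  - by move=> x _; rewrite lee_fin powR_ge0.
  - exact/measurable_EFinP.
  rewrite integral_cst// mul1e lte_add_pinfty//.
    by rewrite (le_lt_trans (probability_le1 _ _))// ltry.
  rewrite ge0_integral_distribution//.
  - by move: EX; rewrite unlock.
  - exact/measurable_EFinP.
  - by move=> x; rewrite lee_fin powR_ge0.
have [dD DE] := derive_KL_smart_path alpha0 lam0 Q1 Q4 t01.
have KLE := KL_gamma_smart_path alpha0 lam0 Q1 Q4 t01.
have JE := Jst_gamma_smart_path alpha0 lam0 Q1 Q4 t01.
split; first by rewrite [KL_gamma _ _ _]KLE.
split; first exact: dD.
by rewrite derive1E [X in X%:E]DE [Jst_gamma _ _ _]JE.
Qed.
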